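(* Let $d\ge1$ be an integer, let $1\le r,p<\infty$ with $p=dr$, and let $T$ be a measure preserving transformation of $(X,\mathcal F,\mu)$. Then for every $f\in L_{p,\pi}(\mu^d)$, $$\frac{1}{n_1n_2\cdots n_d}\sum_{k_1=0}^{n_1-1}\cdots\sum_{k_d=0}^{n_d-1}D_dV^{(k_1,\dots,k_d)}f\;\longrightarrow\; D_d\,E^{\otimes d}_{\mathrm{inv},\pi}f$$ almost surely and in the norm of $L_r(\mu)$ as $n_1,\dots,n_d\to\infty$.
   Context: $(X,\mathcal F,\mu)$ is a standard (Lebesgue) probability space; $L_p(\mu)$ is the space of complex-valued functions with norm $|\cdot|_p$. $L_{p,\pi}(\mu^d)$ is the projective tensor product of $d$ copies of $L_p(\mu)$ (completion of the algebraic tensor product in the largest cross norm); it is identified with a dense linear subspace of $L_p(X^d,\mathcal F^{\otimes d},\mu^d)$ via $f_1\otimes\cdots\otimes f_d\mapsto f_1(x_1)\cdots f_d(x_d)$ (this extends to an injective contraction). For $p=dr$, $r\ge1$, $D_d:L_{p,\pi}(\mu^d)\to L_r(\mu)$ is the norm one linear map determined by $D_d(f_1\otimes\cdots\otimes f_d)(x)=f_1(x)\cdots f_d(x)$ (restriction to the diagonal). $(V^{(k_1,\dots,k_d)}f)(x_1,\dots,x_d)=f(T^{k_1}x_1,\dots,T^{k_d}x_d)$; these operators map $L_{p,\pi}(\mu^d)$ to itself. $E_{\mathrm{inv}}$ is the conditional expectation operator on $L_p(\mu)$ with respect to the $\sigma$-algebra of $T$-invariant sets ($T^{-1}A=A$),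 and $E^{\otimes d}_{\mathrm{inv},\pi}$ is its $d$-th projective tensor power, i.e. the bounded operator on $L_{p,\pi}(\mu^d)$ sending $f_1\otimes\cdots\otimes f_d$ to $E_{\mathrm{inv}}f_1\otimes\cdots\otimes E_{\mathrm{inv}}f_d$. The limit is taken as $n_1,\dots,n_d$ tend to infinity independently. *)

(* Defs.v *)
From HB Require Import structures.
From mathcomp Require Import all_boot all_order all_algebra.
From mathcomp Require Import complex.
From mathcomp Require Import all_classical all_reals all_analysis.
From mathcomp Require Import measurable_realfun.

Set Implicit Arguments.
Unset Strict Implicit.
Unset Printing Implicit Defensive.
Import Order.TTheory GRing.Theory Num.Theory.
Import numFieldNormedType.Exports.
Import ComplexField.Normc.

Local Open Scope classical_set_scope.
Local Open Scope ring_scope.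
Local Open Scope complex_scope.

#[global] Arguments normc {R} x.

(* n_1, ..., n_d tend to infinity independently *)
Definition multi_oo (d : nat) : set_system ('I_d -> nat) :=
  filter_from [set: nat] (fun N => [set n | forall i, (N <= n i)%N]).

Arguments multi_oo d : clear implicits.

#[global] Instance multi_oo_filter d : ProperFilter (multi_oo d).
Proof.
apply: filter_from_proper => [|N _]; last by exists (fun=> N) => /= i.
apply: filter_fromT_filter; first by exists 0%N.
move=> N M; exists (maxn N M) => n /= h; split=> i /=.
- by apply: leq_trans (h i); rewrite leq_maxl.
- by apply: leq_trans (h i); rewrite leq_maxr.
Qed.

Section StandardSpace.
Context {R : realType} {disp : measure_display} {X : measurableType disp}.

(* Lebesgue measure on [0, a] plus atoms of mass w n at the points n + 2 *)
Definition interval_atoms (a : R) (w : nat -> R) (B : set R) : \bar R :=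
  (lebesgue_measure (B `&` `[0%R, a]%classic)
   + \sum_(0 <= n <oo) (w n)%:E * \d_(n.+2%:R : R) B)%E.

(* Isomorphic mod 0 to an interval with Lebesgue measure together with at most
   countably many atoms.  The images phi @` A need only be measurable for the
   completed model, so that mu may or may not be complete. *)
Definition standard_probability (mu : probability X R) : Prop :=
  exists (a : R) (w : nat -> R) (X0 : set X) (Y0 : set R) (phi : X -> R),
  let nu := interval_atoms a w in
  [/\ 0 <= a <= 1 /\ (forall n, 0 <= w n),
      [/\ measurable X0, mu (~` X0) = 0%E,
          measurable Y0 & nu (~` Y0) = 0%E],
      set_bij X0 Y0 phi,
      (forall B, measurable B -> B `<=` Y0 ->
         measurable (X0 `&` phi @^-1` B) /\
         mu (X0 `&` phi @^-1` B) = nu B) &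
      (forall A, measurable A -> A `<=` X0 ->
         exists B1 B2, [/\ measurable B1, measurable B2,
           B1 `<=` phi @` A, phi @` A `<=` B2 & nu (B2 `\` B1) = 0%E])].

End StandardSpace.

Section ComplexLp.
Context {R : realType} {disp : measure_display} {X : measurableType disp}.
Variable mu : probability X R.

Definition cmeasurable (f : X -> R[i]) : Prop :=
  measurable_fun setT (fun x => complex.Re (f x)) /\
  measurable_fun setT (fun x => complex.Im (f x)).

Definition cLnorm (p : R) (f : X -> R[i]) : \bar R :=
  'N[mu]_p%:E[EFin \o (normc \o f)]%E.

Definition cLfun (p : R) : {pred X -> R[i]} :=
  fun f => `[< cmeasurable f /\ (cLnorm p f < +oo)%E >].

Lemma measurable_normc (f : X -> R[i]) :
  cmeasurable f -> measurable_fun setT (fun x => normc (f x)).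
Proof.
move=> [mr mi].
have -> : (fun x => normc (f x)) =
  (fun x => (complex.Re (f x) ^+ 2 + complex.Im (f x) ^+ 2) `^ 2^-1).
  by apply/funext => x; case: (f x) => u v /=;
    rewrite powR12_sqrt// addr_ge0 ?sqr_ge0.
apply: (@measurableT_comp _ _ _ _ _ _ (@powR R ^~ 2^-1)) => //.
by apply: measurable_funD; exact: measurable_funX.
Qed.

Lemma cLfun_submod_closed (p : R) : 1 <= p -> submod_closed (cLfun p).
Proof.
move=> p1; have p0 : p != 0 by rewrite gt_eqF// (lt_le_trans ltr01).
split.
  apply/asboolP; split; first by split; exact: measurable_cst.
  rewrite /cLnorm (_ : EFin \o _ = cst 0%E) ?Lnorm0 ?ltry//.
  by apply/funext => x /=; rewrite expr0n /= addr0 sqrtr0.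
move=> c f g /asboolP[mf lf] /asboolP[mg lg]; apply/asboolP.
have reE (a z w : R[i]) : complex.Re (a * z + w) =
    complex.Re a * complex.Re z - complex.Im a * complex.Im z + complex.Re w.
  by case: a z w => [? ?] [? ?] [? ?].
have imE (a z w : R[i]) : complex.Im (a * z + w) =
    complex.Re a * complex.Im z + complex.Im a * complex.Re z + complex.Im w.
  by case: a z w => [? ?] [? ?] [? ?].
have mcfg : cmeasurable (c *: f + g).
  case: mf mg => fr fi [gr gi]; split.
  - rewrite (_ : (fun _ => _) = (fun x => complex.Re c * complex.Re (f x)
      - complex.Im c * complex.Im (f x) + complex.Re (g x))); last first.
      by apply/funext => x; exact: reE.
    apply: measurable_funD => //; apply: measurable_funB => //;
      exact: measurable_funM.
  - rewrite (_ : (fun _ => _) = (fun x => complex.Re c * complex.Im (f x)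
      + complex.Im c * complex.Re (f x) + complex.Im (g x))); last first.
      by apply/funext => x; exact: imE.
    apply: measurable_funD => //; apply: measurable_funD => //;
      exact: measurable_funM.
split => //.
have mem h : cmeasurable h -> (cLnorm p h < +oo)%E ->
    (fun x => normc (h x)) \in Lfun mu p%:E.
  by move=> mh lh; rewrite !inE; apply/andP; split; rewrite inE //=;
    exact: measurable_normc.
have Hp : (1 <= p%:E :> \bar R)%E by rewrite lee_fin.
have := (Lfun_submod_closed mu Hp).2 (normc c) _ _ (mem _ mf lf) (mem _ mg lg).
rewrite inE => /andP[/[!inE] mF /= lF].
apply: le_lt_trans lF.
rewrite /cLnorm unlock /Lnorm.
apply: gt0_ler_poweR.
- by rewrite invr_ge0 (le_trans ler01 p1).
- by rewrite in_itv/= leey andbT integral_ge0// => x _; exact: poweR_ge0.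
- by rewrite in_itv/= leey andbT integral_ge0// => x _; exact: poweR_ge0.
apply: ge0_le_integral => //=.
- apply/measurable_EFinP.
  apply: (@measurableT_comp _ _ _ _ _ _ (@powR R ^~ p)) => //.
  by apply: measurableT_comp => //; exact: measurable_normc.
- apply/measurable_EFinP.
  apply: (@measurableT_comp _ _ _ _ _ _ (@powR R ^~ p)) => //.
  exact: measurableT_comp.
- move=> x _; rewrite lee_fin ge0_ler_powR ?nnegrE ?(le_trans ler01 p1)//.
  have nc0 (z : R[i]) : 0 <= normc z by case: z => ? ?; exact: sqrtr_ge0.
  rewrite !ger0_norm ?addr_ge0 ?mulr_ge0//.
  by apply: le_trans (le_normcD _ _) _; rewrite normcM.
Qed.

(* Functions, not classes: functions equal mu-a.e. are at distance 0 for the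
   seminorm cLp_norm, and are identified in tensor_eq below. *)
Record cLp (p : R) (p1 : 1 <= p) : Type :=
  CLp { cLp_fun :> X -> R[i]; _ : cLp_fun \in cLfun p }.

Section cLp_lmodule.
Variables (p : R) (p1 : 1 <= p).

HB.instance Definition _ :=
  GRing.isSubmodClosed.Build R[i] (X -> R[i]) (cLfun p)
    (cLfun_submod_closed p1).

HB.instance Definition _ := [isSub of cLp p1 for @cLp_fun p p1].
HB.instance Definition _ := [Choice of cLp p1 by <:].
HB.instance Definition _ := [SubChoice_isSubLmodule of cLp p1 by <:].

Definition cLp_norm (f : cLp p1) : R := fine (cLnorm p f).

End cLp_lmodule.

End ComplexLp.

(* The projective tensor power of a complex vector space V with seminorm N,
   that is, of the normed space V / {N = 0}. *)
Section ProjectiveTensor.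
Context {R : realType} {V : lmodType R[i]} (N : V -> R) (d : nat).

(* The formal linear combination of the elementary tensors
   t 0 (x) ... (x) t (d - 1), (c, t) ranging over the list *)
Definition formal_tensor : Type := seq (R[i] * ('I_d -> V)).

Definition upd (t : 'I_d -> V) (i : 'I_d) (x : V) : 'I_d -> V :=
  fun j => if j == i then x else t j.

Definition formal_scale (a : R[i]) (u : formal_tensor) : formal_tensor :=
  [seq (a * ct.1, ct.2) | ct <- u].

Definition formal_sub (u v : formal_tensor) : formal_tensor :=
  u ++ formal_scale (- 1) v.

(* Equality in the algebraic tensor product: the quotient of the free vector
   space by the multilinearity relations. *)
Inductive tensor_eq : formal_tensor -> formal_tensor -> Prop :=
| tensor_refl u : tensor_eq u u
| tensor_sym u v : tensor_eq u v -> tensor_eq v u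
| tensor_trans u v w : tensor_eq u v -> tensor_eq v w -> tensor_eq u w
| tensor_cat u u' v v' :
    tensor_eq u u' -> tensor_eq v v' -> tensor_eq (u ++ v) (u' ++ v')
| tensor_catC u v : tensor_eq (u ++ v) (v ++ u)
| tensor_coef0 t : tensor_eq [:: (0, t)] [::]
| tensor_coefD a b t : tensor_eq [:: (a + b, t)] [:: (a, t); (b, t)]
| tensor_slotD c t i x y :
    tensor_eq [:: (c, upd t i (x + y))] [:: (c, upd t i x); (c, upd t i y)]
| tensor_slotZ c t i a x :
    tensor_eq [:: (c, upd t i (a *: x))] [:: (c * a, upd t i x)]
| tensor_slot_null c t i x y : N (x - y) = 0 ->
    tensor_eq [:: (c, upd t i x)] [:: (c, upd t i y)].

Definition formal_cost (u : formal_tensor) : R :=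
  \sum_(ct <- u) normc ct.1 * \prod_(i < d) N (ct.2 i).

(* the projective norm, i.e. the largest cross norm *)
Definition proj_norm (u : formal_tensor) : R :=
  inf [set formal_cost v | v in tensor_eq u].

(* Points of the completion are represented by Cauchy sequences; f and g
   represent the same point when proj_norm (f n - g n) tends to 0. *)
Record proj_tensor : Type := ProjTensor {
  proj_seq :> nat -> formal_tensor;
  proj_cauchy : forall e : R, 0 < e -> exists n0, forall m n,
    (n0 <= m)%N -> (n0 <= n)%N ->
    proj_norm (formal_sub (proj_seq m) (proj_seq n)) < e }.

HB.instance Definition _ := gen_eqMixin proj_tensor.
HB.instance Definition _ := gen_choiceMixin proj_tensor.

Definition formal_map (A : 'I_d -> V -> V) (u : formal_tensor) :
  formal_tensor := [seq (ct.1, fun i => A i (ct.2 i)) | ct <- u].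

(* The extension by continuity of A 0 (x) ... (x) A (d - 1), for bounded linear
   maps A i; the default value f is never taken for such maps. *)
Definition tensor_map (A : 'I_d -> V -> V) (f : proj_tensor) : proj_tensor :=
  xget f [set g : proj_tensor |
    proj_norm (formal_sub (formal_map A (f n)) (g n)) @[n --> \oo] --> (0 : R)].

End ProjectiveTensor.

Section Operators.
Context {R : realType} {disp : measure_display} {X : measurableType disp}.
Variable mu : probability X R.

Definition measure_preserving (T : X -> X) : Prop :=
  measurable_fun setT T /\
  forall A, measurable A -> mu (T @^-1` A) = mu A.

Lemma measure_preserving_iter (T : X -> X) (k : nat) :
  measure_preserving T -> measure_preserving (iter k T).
Proof.
move=> [mT muT]; elim: k => [|k [mI muI]].
  by split; [exact: measurable_id|].
split; first exact: (measurableT_comp mT mI).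
move=> A mA; have mTA : measurable (T @^-1` A).
  by rewrite -(setTI (T @^-1` A)); exact: mT.
by rewrite -(muT _ mA) -(muI _ mTA).
Qed.

Lemma cLfun_comp (T : X -> X) (p : R) (f : X -> R[i]) :
  measure_preserving T -> f \in cLfun mu p -> f \o T \in cLfun mu p.
Proof.
move=> [mT muT] /asboolP[[mr mi] lf]; apply/asboolP; split.
  by split; [exact: (measurableT_comp mr mT)|exact: (measurableT_comp mi mT)].
suff -> : cLnorm mu p (f \o T) = cLnorm mu p f by [].
rewrite /cLnorm unlock /Lnorm; congr (_ `^ _)%E.
have mn : measurable_fun setT (fun x => (`|(normc (f x))%:E| `^ p)%E).
  apply/measurable_EFinP => /=.
  apply: (@measurableT_comp _ _ _ _ _ _ (@powR R ^~ p)) => //.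
  by apply: measurableT_comp => //; exact: measurable_normc.
rewrite -(@ge0_integral_pushforward _ _ _ _ R T mT mu setT _ measurableT mn);
  last by move=> x _; exact: poweR_ge0.
by apply: eq_measure_integral => A mA _; exact: muT.
Qed.

Definition invariant_sets (T : X -> X) : set (set X) :=
  [set A | measurable A /\ T @^-1` A = A].

Definition cintegral (A : set X) (f : X -> R[i]) : R[i] :=
  (\int[mu]_(x in A) complex.Re (f x)) +i* (\int[mu]_(x in A) complex.Im (f x)).

(* g is a version of the conditional expectation of f given the sub-sigma-algebra
   G *)
Definition is_cond_exp (G : set (set X)) (f g : X -> R[i]) : Prop :=
  [/\ (forall B : set R, measurable B ->
         G ((fun x => complex.Re (g x)) @^-1` B) /\
         G ((fun x => complex.Im (g x)) @^-1` B)),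
      mu.-integrable setT (fun x => (complex.Re (g x))%:E),
      mu.-integrable setT (fun x => (complex.Im (g x))%:E) &
      forall A, G A -> cintegral A g = cintegral A f].

Section Lp_operators.
Variables (p : R) (p1 : 1 <= p).

(* the projective tensor power L_{p,pi}(mu^d) *)
Definition Lppi (d : nat) : Type := proj_tensor (@cLp_norm _ _ _ mu p p1) d.

Variables (T : X -> X) (hT : measure_preserving T).

Definition koopman (k : nat) (f : cLp mu p1) : cLp mu p1 :=
  CLp p1 (cLfun_comp (measure_preserving_iter k hT) (valP f)).

(* As a function on X^d, (V_op k f) (x_1, ..., x_d) =
   f (T^{k_1} x_1, ..., T^{k_d} x_d). *)
Definition V_op (d : nat) (k : 'I_d -> nat) : Lppi d -> Lppi d :=
  tensor_map (fun i => koopman (k i)).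

(* The default value 0 is never taken: the conditional expectation of an L_p
   function exists and lies in L_p. *)
Definition E_inv (f : cLp mu p1) : cLp mu p1 :=
  xget 0 [set g : cLp mu p1 | is_cond_exp (invariant_sets T) f g].

Definition E_inv_tensor (d : nat) : Lppi d -> Lppi d :=
  tensor_map (fun=> E_inv).

End Lp_operators.

(* restriction of an algebraic tensor to the diagonal *)
Definition formal_diag (p : R) (p1 : 1 <= p) (d : nat)
    (u : @formal_tensor R (cLp mu p1) d) : X -> R[i] :=
  fun x => \sum_(ct <- u) ct.1 * \prod_(i < d) ct.2 i x.

(* D_d : L_{p,pi}(mu^d) -> L_r(mu), the extension by continuity of formal_diag,
   as a limit in L_r; the default value 0 is never taken when p = d * r. *)
Definition D_op (p : R) (p1 : 1 <= p) (r : R) (r1 : 1 <= r) (d : nat)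
    (f : Lppi p1 d) : cLp mu r1 :=
  xget 0 [set g : cLp mu r1 |
    cLnorm mu r (fun x => formal_diag (f n) x - g x) @[n --> \oo] --> 0%E].

End Operators.

(* Main.v *)
Require Import Defs.
From HB Require Import structures.
From mathcomp Require Import all_boot all_order all_algebra.
From mathcomp Require Import complex.
From mathcomp Require Import all_classical all_reals all_analysis.
From mathcomp Require Import measurable_realfun.
From mathcomp Require Import ring lra.

Set Implicit Arguments.
Unset Strict Implicit.
Unset Printing Implicit Defensive.
Import Order.TTheory GRing.Theory Num.Theory.
Import numFieldNormedType.Exports.

Local Open Scope classical_set_scope.
Local Open Scope ring_scope.

Import ComplexField.Normc.

Local Open Scope complex_scope.

(* A Cauchy sequence representing f is replaced by an absolutely summable series
   of elementary tensors c t_1 (x) ... (x) t_d, normalized as w s_1 (x) ... (x) s_d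
   with w = |c| |t_1|_p ... |t_d|_p and |s_i|_p = 1.  Since
   (s_1 ... s_d)^r <= s_1^p + ... + s_d^p pointwise and y |-> y^r is convex, a
   tail of the series with weights of sum at most 1 satisfies
     |D_d V^k tail (x)|^r <= sum_i h (T^(k_i) x),   h = sum_l w_l sum_i s_(l,i)^p,
   where h is in L_1 with integral at most d times the sum of the weights.
   Averaging over a box turns the right-hand side into a sum of one-parameter
   Birkhoff averages of h.  By Birkhoff's theorem these converge, and their limits
   tend to 0 almost everywhere along the tails; for a finite sum of elementary
   tensors the averages factor into products of one-parameter averages.  This gives
   almost sure convergence with no maximal inequality in L_p, hence no separate
   treatment of p = 1.  The same domination by Birkhoff averages, whose integrals
   do not depend on the box, gives convergence in L_r by Fatou's lemma. *)

(** * Birkhoff's ergodic theorem *)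

(** The operators [koopman (k i)] are isometries acting slot by slot, so a normalized series for f
    is carried to a normalized series for V^k f with the same weights. This is why one function h,
    chosen before k, controls all the d-parameter averages, and why the bound splits into functions
    of a single coordinate k_i. The obstacle is that [D_op], [E_inv] and [tensor_map] choose
    arbitrary representatives: a pointwise statement about them holds off a null set that depends on
    k. These null sets are gathered over the countably many multi-indices before any x is fixed.
    Fatou's lemma concerns sequences while [multi_oo d] is a filter on multi-indices, so norm
    convergence is proved by contradiction along a sequence of boxes. Linearity of [E_inv] up to
    null functions and its contraction property in L_p are both read off from Birkhoff's theorem. *)

Section MeasurePreserving.
Context {R : realType} {disp : measure_display} {X : measurableType disp}.
Variables (mu : probability X R) (T : X -> X) (hT : measure_preserving mu T).

Lemma measurable_mp : measurable_fun setT T.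
Proof. by case: hT. Qed.

Lemma measure_mp A : measurable A -> mu (T @^-1` A) = mu A.
Proof. by case: hT => _; exact. Qed.

Lemma integrable_mp (u : X -> \bar R) :
  mu.-integrable setT u -> mu.-integrable setT (u \o T).
Proof.
move=> /integrableP[mu_ iu]; apply/integrableP; split.
  exact: measurableT_comp measurable_mp.
suff -> : (\int[mu]_x `|(u \o T) x| = \int[mu]_x `|u x|)%E by [].
have := @ge0_integral_pushforward _ _ _ _ R T measurable_mp mu setT
  (fun x => `|u x|%E) measurableT.
rewrite preimage_setT => <- //; last 1 first.
- exact: measurableT_comp.
apply: eq_measure_integral => [|? A mA _]; [exact: measurable_mp|exact: measure_mp].
Qed.

Lemma ge0_integral_mp (u : X -> \bar R) : measurable_fun setT u ->
  (forall x, (0 <= u x)%E) -> (\int[mu]_x u (T x) = \int[mu]_x u x)%E.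
Proof.
move=> mu_ u0.
have := @ge0_integral_pushforward _ _ _ _ R T measurable_mp mu setT
  u measurableT.
rewrite preimage_setT => <- //.
apply: eq_measure_integral => [|? A mA _]; [exact: measurable_mp|exact: measure_mp].
Qed.

Lemma integral_mp (u : X -> \bar R) :
  mu.-integrable setT u -> (\int[mu]_x u (T x) = \int[mu]_x u x)%E.
Proof.
move=> iu; have iuT := integrable_mp iu.
have := @integral_pushforward _ _ _ _ R T measurable_mp mu setT u.
rewrite preimage_setT => <- //; last exact: measurable_int iu.
apply: eq_measure_integral => [|? A mA _]; [exact: measurable_mp|exact: measure_mp].
Qed.

Lemma ae_mp (P : X -> Prop) : {ae mu, forall x, P x} ->
  {ae mu, forall x, P (T x)}.
Proof.
move=> [B [mB B0 PB]]; exists (T @^-1` B); split.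
- by rewrite -[X in measurable X]setTI; exact: measurable_mp.
- by rewrite measure_mp.
- by move=> x /= nP; exact: PB.
Qed.

Lemma ae_mp_iter (P : X -> Prop) : {ae mu, forall x, P x} ->
  {ae mu, forall x, forall k, P (iter k T x)}.
Proof.
move=> aeP; apply: ae_foralln => k.
elim: k P aeP => // k IH P aeP.
by apply: (IH (fun x => P (T x))); exact: ae_mp.
Qed.

End MeasurePreserving.

(** * The maximal ergodic theorem *)

Section Maximal.
Context {R : realType} {disp : measure_display} {X : measurableType disp}.
Variables (mu : probability X R) (T : X -> X) (hT : measure_preserving mu T).

Definition birkhoff_sum (u : X -> R) n x : R := \sum_(k < n) u (iter k T x).

Lemma birkhoff_sumS u n x :
  birkhoff_sum u n.+1 x = u x + birkhoff_sum u n (T x).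
Proof.
rewrite /birkhoff_sum big_ord_recl /=; congr (_ + _).
by apply: eq_bigr => i _; rewrite /= add0n -iterSr.
Qed.

(* max_sum u n is the maximum of the Birkhoff sums of order at most n, computed
   from S_(m+1) u x = u x + S_m u (T x). *)
Fixpoint max_sum (u : X -> R) n x : R :=
  if n is n'.+1 then Num.max 0 (u x + max_sum u n' (T x)) else 0.

Lemma max_sum_ge0 u n x : 0 <= max_sum u n x.
Proof. by case: n => //= n; rewrite le_max lexx. Qed.

Lemma max_sum_ndS u n x : max_sum u n x <= max_sum u n.+1 x.
Proof.
elim: n x => [|n IH] x; first exact: max_sum_ge0.
rewrite [X in X <= _]/= [X in _ <= X]/=.
by rewrite ge_max !le_max lexx /= lerD2l IH orbT.
Qed.

Lemma max_sum_nd u x : {homo max_sum u ^~ x : m n / (m <= n)%N >-> m <= n}.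
Proof. by apply: homo_leq => [//||n]; [exact: le_trans|exact: max_sum_ndS]. Qed.

Lemma birkhoff_sum_le_max u n x : birkhoff_sum u n x <= max_sum u n x.
Proof.
elim: n x => [|n IH] x; first by rewrite /birkhoff_sum big_ord0.
by rewrite birkhoff_sumS /= le_max lerD2l IH orbT.
Qed.

Lemma measurable_max_sum u n : measurable_fun setT u ->
  measurable_fun setT (max_sum u n).
Proof.
move=> mfu; elim: n => [|n IH] /=; first exact: measurable_cst.
apply: measurable_maxr => //; apply: measurable_funD => //.
exact: (measurableT_comp IH (measurable_mp hT)).
Qed.

Lemma integrable_max_sum u n : mu.-integrable setT (EFin \o u) ->
  mu.-integrable setT (EFin \o max_sum u n).
Proof.
move=> iu; have /measurable_EFinP mfu := measurable_int _ iu.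
elim: n => [|n IH]; first exact: integrable0.
have iM := integrable_mp hT IH.
apply: (le_integrable measurableT _ _ (integrableD measurableT iu iM)) => /=.
  by apply/measurable_EFinP; exact: (measurable_max_sum n.+1 mfu).
move=> x _; rewrite lee_fin ger0_norm ?le_max ?lexx//.
by rewrite ge_max normr_ge0 ler_norm.
Qed.

(** Garsia's argument for Hopf's lemma. Where [max_sum u n] is positive, it is u plus the maximum of
    order n - 1 at T x, hence at most u plus [max_sum u n] at T x. Elsewhere it is 0, and
    subtracting its value at T x gives at most 0. The integral of this difference vanishes because T
    preserves mu. *)
Lemma integral_max_sum_ge0 u n : mu.-integrable setT (EFin \o u) ->
  (0 <= \int[mu]_x (u x * \1_[set y | 0 < max_sum u n y] x)%:E)%E.
Proof.
move=> iu; have /measurable_EFinP mfu := measurable_int _ iu.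
have iM := integrable_max_sum n iu.
have iMT := integrable_mp hT iM.
have mE : measurable [set y | 0 < max_sum u n y].
  rewrite -[X in measurable X]setTI.
  rewrite (_ : [set y | _] = max_sum u n @^-1` `]0, +oo[); last first.
    by apply/seteqP; split=> y /=; rewrite in_itv/= andbT.
  exact: measurable_max_sum.
apply: (@le_trans _ _ (\int[mu]_x ((max_sum u n x)%:E - (max_sum u n (T x))%:E))%E).
  by rewrite integralB//= (integral_mp hT iM) subee// integrable_fin_num.
apply: le_integral => //=.
- exact: (integrableB measurableT iM iMT).
- apply: (le_integrable measurableT _ _ iu) => //=.
    apply/measurable_EFinP; apply: measurable_funM => //.
  move=> x _; rewrite lee_fin normrM ler_piMr// indicE.
  by case: (_ \in _) => /=; rewrite ?normr1 ?normr0.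
move=> x _; rewrite lee_fin indicE; have [/set_mem/= Mx|/negP Mx] := boolP (x \in _).
  case: n {iM iMT mE} Mx => [|n]; first by rewrite /= ltxx.
  rewrite mulr1 lerBlDr => Mx.
  move: (Mx) => /=; rewrite lt_max ltxx /= => Mx0; rewrite max_r ?(ltW Mx0)//.
  by rewrite lerD2l; exact: (max_sum_ndS u n (T x)).
rewrite mulr0 subr_le0; apply: le_trans (max_sum_ge0 _ _ _).
by rewrite leNgt; apply/negP => ?; apply: Mx; exact/mem_set.
Qed.

(** The recursion of [max_sum] only relates x to T x, and an invariant B contains both or neither;
    this localizes the maximal inequality to B. *)
Lemma max_sum_indic u (B : set X) n x : T @^-1` B = B ->
  max_sum (fun x => u x * \1_B x) n x = max_sum u n x * \1_B x.
Proof.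
move=> TB; elim: n x => [|n IH] x /=; first by rewrite mul0r.
rewrite IH.
have -> : \1_B (T x) = \1_B x :> R by rewrite !indicE -[in RHS]TB.
by rewrite -mulrDl -[in LHS](mul0r (\1_B x)) maxr_pMl ?indicE.
Qed.

(** Hopf's lemma for u cut off to B: by hypothesis the sets where the maxima are positive grow to
    all of B, and the integrals converge under the dominating function |u 1_B|. *)
Lemma maximal_ergodic u (B : set X) : mu.-integrable setT (EFin \o u) ->
  measurable B -> T @^-1` B = B ->
  (forall x, B x -> exists n, 0 < birkhoff_sum u n x) ->
  (0 <= \int[mu]_(x in B) (u x)%:E)%E.
Proof.
move=> iu mB TB Bpos; have /measurable_EFinP mfu := measurable_int _ iu.
have iuB : mu.-integrable setT (fun x => (u x * \1_B x)%:E).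
  apply: (le_integrable measurableT _ _ iu) => //=.
    by apply/measurable_EFinP; exact: measurable_funM.
  move=> x _; rewrite lee_fin normrM ler_piMr// indicE.
  by case: (_ \in _) => /=; rewrite ?normr1 ?normr0.
pose E n := [set y | 0 < max_sum (fun x => u x * \1_B x) n y].
have mE n : measurable (E n).
  rewrite -[X in measurable X]setTI.
  rewrite (_ : E n = max_sum (fun x => u x * \1_B x) n @^-1` `]0, +oo[); last first.
    by apply/seteqP; split=> y /=; rewrite in_itv/= andbT.
  by apply: measurable_max_sum => //; exact: measurable_funM.
have cvgE x : (u x * \1_B x * \1_(E n) x)%:E @[n --> \oo] --> (u x * \1_B x)%:E.
  have [Bx|nBx] := boolP (x \in B); last first.
    rewrite indicE (negbTE nBx) mulr0 (_ : (fun _ => _) = cst 0%E); first exact: cvg_cst.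
    by apply/funext => n; rewrite mul0r.
  have [m Sm] : exists n, 0 < birkhoff_sum u n x by apply: Bpos; rewrite inE in Bx.
  apply: cvg_near_cst; exists m => // n /= mn; congr EFin.
  suff -> : \1_(E n) x = 1 :> R by rewrite mulr1.
  rewrite indicE mem_set//= /E /= max_sum_indic// indicE Bx mulr1.
  apply: lt_le_trans Sm _; apply: le_trans (birkhoff_sum_le_max _ _ _) _.
  exact: max_sum_nd.
have -> : (\int[mu]_(x in B) (u x)%:E = \int[mu]_x (u x * \1_B x)%:E)%E.
  rewrite integral_mkcond; apply: eq_integral => x _.
  by rewrite patchE indicE; case: ifP => _; rewrite ?mulr1 ?mulr0.
have H : (\int[mu]_x (u x * \1_B x * \1_(E n) x)%:E)%E @[n --> \oo] -->
    (\int[mu]_x (u x * \1_B x)%:E)%E.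
  apply: (@dominated_cvg _ _ _ mu setT measurableT _ _ (fun x => `|(u x * \1_B x)%:E|%E)) => //=.
  - by move=> n; apply/measurable_EFinP; apply: measurable_funM => //;
      exact: measurable_funM.
  - exact: (integrable_abse iuB).
  - move=> n x _; rewrite lee_fin normrM ler_piMr// indicE.
    by case: (_ \in _) => /=; rewrite ?normr1 ?normr0.
apply: cvge_ge H; apply: nearW => n; exact: (integral_max_sum_ge0 n iuB).
Qed.
End Maximal.

(** * The pointwise ergodic theorem *)

Section Birkhoff.
Context {R : realType} {disp : measure_display} {X : measurableType disp}.
Variables (mu : probability X R) (T : X -> X) (hT : measure_preserving mu T).

Lemma measurable_birkhoff_sum (u : X -> R) n : measurable_fun setT u ->
  measurable_fun setT (birkhoff_sum T u n).
Proof.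
move=> mfu; apply: measurable_sum => k.
exact: (measurableT_comp mfu (measurable_mp (measure_preserving_iter k hT))).
Qed.

Lemma birkhoff_sum_cst (c : R) n x : birkhoff_sum T (cst c) n x = n%:R * c.
Proof. by rewrite /birkhoff_sum sumr_const card_ord mulr_natl. Qed.

Lemma birkhoff_sumB (u v : X -> R) n x :
  birkhoff_sum T (fun x => u x - v x) n x =
  birkhoff_sum T u n x - birkhoff_sum T v n x :> R.
Proof. by rewrite /birkhoff_sum -sumrB. Qed.

(** On the invariant set B where the sums of v - e are unbounded above, the maximal theorem and the
    hypothesis on v give 0 <= - e mu(B), so B is null. The constant K depends on x but disappears
    after division by n. *)
Lemma birkhoff_sum_upper (v : X -> R) (e : R) : mu.-integrable setT (EFin \o v) ->
  (forall A, invariant_sets T A -> (\int[mu]_(x in A) (v x)%:E = 0)%E) ->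
  0 < e ->
  {ae mu, forall x, exists K : nat, forall n,
    birkhoff_sum T v n x <= n%:R * e + K%:R}.
Proof.
move=> iv v0 e0; have /measurable_EFinP mfv := measurable_int _ iv.
pose w x := v x - e.
have Sw n x : birkhoff_sum T w n x = birkhoff_sum T v n x - n%:R * e.
  by rewrite -(birkhoff_sum_cst e n x) -birkhoff_sumB.
have mw : measurable_fun setT w by apply: measurable_funB.
(* Unlike {limsup (S_n v / n) > e}, for which only approximate invariance is
   immediate, the set where S_n (v - e) is unbounded is visibly invariant. *)
pose B := [set x | forall K : nat, exists n, K%:R < birkhoff_sum T w n x].
have mB : measurable B.
  rewrite (_ : B = \bigcap_(K in [set: nat]) \bigcup_(n in [set: nat])
      (birkhoff_sum T w n @^-1` `]K%:R, +oo[)); last first.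
    apply/seteqP; split=> x /=.
      by move=> Bx K _; have [n Kn] := Bx K; exists n => //=; rewrite in_itv/= Kn.
    by move=> Bx K; have [n _] := Bx K I; rewrite /= in_itv/= andbT; exists n.
  apply: bigcap_measurable => // K _; apply: bigcup_measurable => n _.
  by rewrite -[X in measurable X]setTI; exact: measurable_birkhoff_sum.
have TB : T @^-1` B = B.
  apply/seteqP; split=> x /= Bx K.
  (* The margin above |w x| pays for one application of T, since the sums of order n + 1 at x and of
     order n at T x differ by w x. *)
  - have [n Kn] := Bx (K + Num.truncn `|w x|).+1.
    exists n.+1; rewrite birkhoff_sumS.
    have := ler_norm (- w x); move: Kn (truncnS_gt `|w x|).
    rewrite normrN -!natr1 !natrD; lra.
  - have [[|n] Kn] := Bx (K + Num.truncn `|w x|).+1.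
      by move: Kn; rewrite /birkhoff_sum big_ord0 ltNge ler0n.
    exists n; move: Kn; rewrite birkhoff_sumS.
    have := ler_norm (w x); move: (truncnS_gt `|w x|).
    rewrite -!natr1 !natrD; lra.
have iw : mu.-integrable setT (EFin \o w).
  have icst : mu.-integrable setT (EFin \o cst e).
    exact: finite_measure_integrable_cst.
  exact: (integrableB measurableT iv icst).
have := maximal_ergodic hT iw mB TB (fun x Bx => Bx 0%N).
under eq_integral do rewrite EFinB.
rewrite integralB//=; last 2 first.
- exact: (integrableS measurableT).
- by apply: (integrableS measurableT) => //; exact: finite_measure_integrable_cst.
rewrite v0// sub0e integral_cst// oppe_ge0 pmule_rle0 ?lte_fin// => muB.
exists B; split => //; first by apply/eqP; rewrite eq_le muB measure_ge0.
move=> x /= nx K; apply: contrapT => nK; apply: nx; exists K => n.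
rewrite -lerBlDl -Sw leNgt; apply/negP => Kn; apply: nK; by exists n.
Qed.

Definition birkhoff_avg (u : X -> R) n x : R := n%:R^-1 * birkhoff_sum T u n x.

(** Because g is invariant at every point, its Birkhoff sums are exactly n g. The one-sided bound
    for u - g and for g - u, with all slopes 1/(j+1) at once, then gives the two halves of the
    limit. *)
Theorem birkhoff (u g : X -> R) : mu.-integrable setT (EFin \o u) ->
  mu.-integrable setT (EFin \o g) -> (forall x, g (T x) = g x) ->
  (forall A, invariant_sets T A ->
    (\int[mu]_(x in A) (g x)%:E = \int[mu]_(x in A) (u x)%:E)%E) ->
  {ae mu, forall x, birkhoff_avg u n x @[n --> \oo] --> g x}.
Proof.
move=> iu ig gT gu.
have iuS A : measurable A -> mu.-integrable A (EFin \o u).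
  by move=> mA; exact: (integrableS measurableT).
have igS A : measurable A -> mu.-integrable A (EFin \o g).
  by move=> mA; exact: (integrableS measurableT).
have aep : {ae mu, forall x, forall j : nat, exists K : nat, forall n,
    birkhoff_sum T (fun x => u x - g x) n x <= n%:R * j.+1%:R^-1 + K%:R}.
  apply: ae_foralln => j; apply: birkhoff_sum_upper => //.
    exact: (integrableB measurableT iu ig).
  move=> A [mA TA]; under eq_integral do rewrite EFinB.
  rewrite integralB//=; [|exact: iuS|exact: igS].
  by rewrite gu// subee// integrable_fin_num//; exact: iuS.
have aem : {ae mu, forall x, forall j : nat, exists K : nat, forall n,
    birkhoff_sum T (fun x => g x - u x) n x <= n%:R * j.+1%:R^-1 + K%:R}.
  apply: ae_foralln => j; apply: birkhoff_sum_upper => //.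
    exact: (integrableB measurableT ig iu).
  move=> A [mA TA]; under eq_integral do rewrite EFinB.
  rewrite integralB//=; [|exact: igS|exact: iuS].
  by rewrite gu// subee// integrable_fin_num//; exact: iuS.
apply: filterS2 aep aem => x hp hm.
have Sg n : birkhoff_sum T g n x = n%:R * g x.
  rewrite -(birkhoff_sum_cst (g x) n x); apply: eq_bigr => k _ /=.
  by elim: (val k) => //= m <-.
apply/cvgrPdist_le => e e0.
pose j := Num.truncn (2 / e).
have ej : j.+1%:R^-1 <= e / 2.
  rewrite invf_ple ?posrE ?divr_gt0 ?ltr0n// invf_div ltW//.
  exact: truncnS_gt.
have [K1 hK1] := hp j; have [K2 hK2] := hm j.
pose K := (K1 + K2)%N.
(* From this n on, K is at most n e / 2; the slope 1/(j+1) uses the other half of e. *)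
exists (Num.truncn (2 / e * K%:R)).+1 => // n /= Kn.
have n0 : 0 < n%:R :> R by rewrite ltr0n (leq_ltn_trans _ Kn).
have Kne : K%:R <= n%:R * (e / 2).
  rewrite mulrC -ler_pdivrMl ?divr_gt0// invf_div.
  apply: ltW; apply: lt_le_trans (truncnS_gt _) _.
  by rewrite ler_nat.
have {}hK1 := hK1 n; have {}hK2 := hK2 n.
have nj : n%:R * j.+1%:R^-1 <= n%:R * (e / 2) by rewrite ler_pM2l.
have K1K : K1%:R <= K%:R :> R by rewrite ler_nat leq_addr.
have K2K : K2%:R <= K%:R :> R by rewrite ler_nat leq_addl.
move: hK1 hK2; rewrite !birkhoff_sumB Sg => hK1 hK2.
rewrite /birkhoff_avg -(ler_pM2l n0) -[X in X * `|_|](gtr0_norm n0) -normrM.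
rewrite mulrBr mulrA mulfV ?gt_eqF// mul1r ler_norml; rewrite [e in n%:R * e]splitr mulrDr.
have le1 := le_trans hK1 (lerD nj (le_trans K1K Kne)).
have le2 := le_trans hK2 (lerD nj (le_trans K2K Kne)).
by rewrite lerNl opprB le1 le2.
Qed.

End Birkhoff.

(** * Conditional expectation given the invariant sets *)

Section SigmaSub.
Context {R : realType} {disp : measure_display} {X : measurableType disp}.
Variables (mu : probability X R) (G : set (set X)).
Hypothesis sG : sigma_algebra setT G.
Hypothesis GM : G `<=` measurable.

(** The identity, with a target that carries only the sigma-algebra G: pushing mu forward along it
    amounts to restricting mu to G. *)
Definition to_sub (x : X) : g_sigma_algebraType G := x.

Lemma measurable_to_sub : measurable_fun setT to_sub.
Proof.
move=> _ A; rewrite setTI /measurable/= sigma_algebra_id// => GA.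
exact: GM.
Qed.

HB.instance Definition _ := isMeasurableFun.Build _ _ _ _ to_sub measurable_to_sub.

(* Radon-Nikodym on the sub-sigma-algebra, the charge A |-> \int_A u being
   pushed forward along the identity. *)
Lemma cond_exp_exists_sub (u : X -> R) : mu.-integrable setT (EFin \o u) ->
  exists g : X -> R, [/\ forall B, measurable B -> G (g @^-1` B),
    mu.-integrable setT (EFin \o g) &
    forall A, G A -> (\int[mu]_(x in A) (g x)%:E = \int[mu]_(x in A) (u x)%:E)%E].
Proof.
move=> iu.
pose P : probability _ R := distribution mu to_sub.
pose C' : {charge set (g_sigma_algebraType G) -> \bar R} :=
  pushforward (induced_charge iu) to_sub.
pose C := C' measurable_to_sub.
have mG A : measurable (A : set (g_sigma_algebraType G)) = G A.
  by rewrite measurable_g_measurableTypeE.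
have CP : C `<< P.
  apply/null_content_dominatesP => A mA PA0; rewrite /C/C'/= /pushforward /induced_charge.
  rewrite null_set_integral//; first by apply: GM; rewrite mG in mA.
  exact: measurable_funTS (measurable_int _ iu).
pose g' := Radon_Nikodym C P.
have g'fin x : g' x \is a fin_num by exact: Radon_Nikodym_fin_num.
have ig' : P.-integrable setT g' by exact: Radon_Nikodym_integrable.
have mg' : measurable_fun setT g' by exact: measurable_int ig'.
have mf : measurable_fun setT (g' : X -> \bar R).
  exact: (measurableT_comp mg' measurable_to_sub).
have ig : mu.-integrable setT (g' : X -> \bar R).
  apply/integrableP; split => //.
  move/integrableP : ig' => [_]; apply: le_lt_trans.
  rewrite ge0_integral_pushforward//.
  exact: measurableT_comp.
exists (fine \o g').
have Eg : EFin \o (fine \o g') = g' by apply/funext => x /=; rewrite fineK.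
split.
- move=> B mB; rewrite -mG -[X in measurable X]setTI.
  by apply: (measurableT_comp _ mg').
- by rewrite Eg.
move=> A GA; under eq_integral do rewrite fineK//.
have mA : measurable (A : set (g_sigma_algebraType G)) by rewrite mG.
have := Radon_Nikodym_integral CP mA.
rewrite integral_pushforward//.
  by apply: (integrableS measurableT _ _ ig) => //; exact: GM.
Qed.
End SigmaSub.

Section CondExp.
Context {R : realType} {disp : measure_display} {X : measurableType disp}.
Variables (mu : probability X R) (T : X -> X) (hT : measure_preserving mu T).

Lemma sigma_algebra_invariant : sigma_algebra setT (invariant_sets T : set (set X)).
Proof.
split.
- by split => //; rewrite preimage_set0.
- move=> A [mA TA]; rewrite setTD; split; first exact: measurableC.
  by rewrite -preimage_setC TA.
- move=> A HA; split; first by apply: bigcupT_measurable => n; case: (HA n).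
  by rewrite preimage_bigcup; apply: eq_bigcupr => n _; case: (HA n).
Qed.

Lemma invariant_cond_exp_exists (u : X -> R) : mu.-integrable setT (EFin \o u) ->
  exists g : X -> R, [/\ forall B, measurable B -> invariant_sets T (g @^-1` B),
    mu.-integrable setT (EFin \o g) &
    forall A, invariant_sets T A ->
      (\int[mu]_(x in A) (g x)%:E = \int[mu]_(x in A) (u x)%:E)%E].
Proof.
apply: cond_exp_exists_sub; first exact: sigma_algebra_invariant.
by move=> A [].
Qed.

(** The level set of g through x is strictly invariant, hence contains T x; the equality therefore
    holds at every x and not merely almost everywhere. *)
Lemma invariant_fun (g : X -> R) :
  (forall B, measurable B -> invariant_sets T (g @^-1` B)) ->
  forall x, g (T x) = g x.
Proof.
move=> hg x; have [_ E] := hg [set g x] (measurable_set1 _).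
by have : (T @^-1` (g @^-1` [set g x])) x by rewrite E.
Qed.

End CondExp.

(** * Convexity inequalities and convergence of integrals *)

Section Jensen.
Context {R : realType}.
Variables (r : R) (r1 : 1 <= r).

Lemma ge1_gt0 : 0 < r. Proof. exact: lt_le_trans r1. Qed.

(** Induction on the list: the head and the renormalized rest form a two-point convex combination
    with weights [w i] and z. A total weight below 1 amounts to placing the missing mass at 0, whose
    r-th power is 0. *)
Lemma jensen_powR (I : Type) (s : seq I) (w y : I -> R) :
  (forall i, 0 <= w i) -> (forall i, 0 <= y i) -> \sum_(i <- s) w i <= 1 ->
  (\sum_(i <- s) w i * y i) `^ r <= \sum_(i <- s) w i * y i `^ r.
Proof.
move=> w0 y0; elim: s w w0 => [|i s IH] w w0.
  by rewrite !big_nil powR0// gt_eqF// ge1_gt0.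
rewrite !big_cons => w1.
have S0 : 0 <= \sum_(j <- s) w j by exact: sumr_ge0.
have wi1 : w i <= 1 by apply: le_trans w1; rewrite lerDl.
set z := 1 - w i.
have zw : \sum_(j <- s) w j <= z by rewrite /z lerBrDl.
(* If the head takes the whole mass, renormalizing by z is impossible, but then all other weights
   vanish. *)
have := wi1; rewrite -subr_ge0 -/z le_eqVlt => /predU1P[z0|zp].
  have ws0 (f : I -> R) : \sum_(j <- s) w j * f j = 0.
    have : \sum_(j <- s) w j = 0.
      by apply/le_anti; rewrite S0 andbT [X in _ <= X]z0.
    elim: s {IH w1 S0 zw} => [|j s IH]; first by rewrite !big_nil.
    rewrite !big_cons => /eqP; rewrite paddr_eq0 ?sumr_ge0//.
    by move=> /andP[/eqP -> /eqP/IH ->]; rewrite mul0r add0r.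
  by rewrite !ws0 !addr0 -[w i](subKr 1) -/z -z0 subr0 !mul1r.
pose w' j := w j / z.
have w'0 j : 0 <= w' j by rewrite divr_ge0// ltW.
have sumw' (f : I -> R) : \sum_(j <- s) w j * f j = z * \sum_(j <- s) w' j * f j.
  by rewrite mulr_sumr; apply: eq_bigr => j _; rewrite /w' mulrA mulrCA divff ?gt_eqF// mulr1.
rewrite !sumw'.
have := convex_powR r1 (Itv01 (w0 i) wi1).
move=> /(_ (y i) (\sum_(j <- s) w' j * y j)).
rewrite !inE/= !in_itv/= !andbT => /(_ (y0 i) (sumr_ge0 _ _)).
rewrite !convRE /= => H.
apply: le_trans (H _) _; first by move=> j _; rewrite mulr_ge0.
rewrite lerD2l ler_wpM2l// ?(ltW zp)//; apply: IH => //.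
by rewrite -mulr_suml ler_pdivrMr// mul1r; exact: zw.
Qed.

(** Dividing the weights by W brings their sum down to at most 1; the factor 1 / W that remains on
    the right is at most 1 and is dropped. *)
Lemma jensen_powR_scaled (I : Type) (s : seq I) (w y : I -> R) (W : R) :
  (forall i, 0 <= w i) -> (forall i, 0 <= y i) -> 1 <= W ->
  \sum_(i <- s) w i <= W ->
  (\sum_(i <- s) w i * y i) `^ r <= W `^ r * \sum_(i <- s) w i * y i `^ r.
Proof.
move=> w0 y0 W1 wW; have W0 : 0 < W by exact: lt_le_trans W1.
have -> : \sum_(i <- s) w i * y i = W * \sum_(i <- s) (w i / W) * y i.
  by rewrite mulr_sumr; apply: eq_bigr => j _; rewrite mulrA mulrCA divff ?gt_eqF// mulr1.
rewrite powRM ?(ltW W0)//; last first.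
  by apply: sumr_ge0 => i _; rewrite mulr_ge0// divr_ge0// ltW.
rewrite ler_wpM2l ?powR_ge0//.
apply: (@le_trans _ _ (\sum_(i <- s) w i / W * y i `^ r)).
  apply: jensen_powR => // [i|]; first by rewrite divr_ge0// ltW.
  by rewrite -mulr_suml ler_pdivrMr// mul1r.
apply: ler_sum => i _; apply: ler_wpM2r; first exact: powR_ge0.
by rewrite ler_pdivrMr// ler_peMr.
Qed.

Lemma powRD_le (a b : R) : 0 <= a -> 0 <= b ->
  (a + b) `^ r <= 2 `^ r * (a `^ r + b `^ r).
Proof.
move=> a0 b0; have r0 := ltW ge1_gt0.
wlog ab : a b a0 b0 / a <= b.
  move=> H; have /orP[ab|ba] := le_total a b; first exact: H.
  by rewrite addrC [X in _ * X]addrC; exact: H.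
apply: (@le_trans _ _ ((2 * b) `^ r)).
  by rewrite ge0_ler_powR ?nnegrE ?addr_ge0 ?mulr_ge0//; lra.
by rewrite powRM// ler_wpM2l ?powR_ge0// lerDr powR_ge0.
Qed.

Lemma le_1DpowR (a : R) : 0 <= a -> a <= 1 + a `^ r.
Proof.
move=> a0; have /orP[a1|a1] := le_total a 1.
  by apply: le_trans a1 _; rewrite lerDl powR_ge0.
apply: (@le_trans _ _ (a `^ r)); last by rewrite lerDr.
by rewrite -[X in X <= _]powRr1//; apply: ler_powR.
Qed.

(** Every factor is at most the largest one, and the power d r of the largest is one of the
    summands. This is the source of the relation p = d r. *)
Lemma prodr_powR_le (d : nat) (s : 'I_d -> R) : (0 < d)%N ->
  (forall i, 0 <= s i) ->
  (\prod_i s i) `^ r <= \sum_i s i `^ (d%:R * r).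
Proof.
case: d s => // d s _ s0.
have [i0 _ max0] := @arg_maxP _ _ _ ord0 xpredT s isT.
apply: (@le_trans _ _ ((s i0 ^+ d.+1) `^ r)).
  apply: ge0_ler_powR; rewrite ?nnegrE ?(ltW ge1_gt0) ?prodr_ge0 ?exprn_ge0//.
  rewrite -[X in _ ^+ X](card_ord d.+1) -prodr_const.
  by apply: ler_prod => i _; rewrite s0; exact: max0.
rewrite -powR_mulrn// -powRrM (bigD1 i0)//= lerDl.
by apply: sumr_ge0 => i _; exact: powR_ge0.
Qed.

End Jensen.

Section Convergence.
Context {R : realType} {disp : measure_display} {X : measurableType disp}.
Variables (mu : probability X R).

Lemma ae_nneseries_lty (u : nat -> X -> \bar R) (c : nat -> R) :
  (forall n, measurable_fun setT (u n)) -> (forall n x, (0 <= u n x)%E) ->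
  (forall n, (\int[mu]_x u n x <= (c n)%:E)%E) ->
  (\sum_(n <oo) (c n)%:E < +oo)%E ->
  {ae mu, forall x, (\sum_(n <oo) u n x < +oo)%E}.
Proof.
move=> mu_ u0 uc csum.
have iu : mu.-integrable setT (fun x => \sum_(n <oo) u n x)%E.
  apply/integrableP; split.
    exact: ge0_emeasurable_sum.
  under eq_integral do rewrite gee0_abs ?nneseries_ge0//.
  rewrite integral_nneseries//; apply: le_lt_trans csum.
  by apply: lee_nneseries => // n _ *; apply: integral_ge0 => *; exact: u0.
apply: filterS (integrable_ae measurableT iu) => x /(_ I).
by rewrite ge0_fin_numE// nneseries_ge0.
Qed.

Lemma fatou_ae (K : nat -> X -> R) (k : X -> R) (c : \bar R) :
  (forall m, measurable_fun setT (K m)) -> measurable_fun setT k ->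
  (forall m x, 0 <= K m x) ->
  {ae mu, forall x, K m x @[m --> \oo] --> k x} ->
  (forall m, (\int[mu]_x (K m x)%:E <= c)%E) -> (\int[mu]_x (k x)%:E <= c)%E.
Proof.
move=> mK mk K0 Kk Kc.
have mEK m : measurable_fun setT (EFin \o K m) by exact/measurable_EFinP.
have mli : measurable_fun setT (fun x => limn_einf (fun m => (K m x)%:E)).
  apply: measurableT_comp => //; apply: measurable_fun_limn_esup => m.
  by apply: measurableT_comp => //; exact: mEK.
have -> : (\int[mu]_x (k x)%:E = \int[mu]_x limn_einf (fun m => (K m x)%:E))%E.
  apply: ae_eq_integral => //; first exact/measurable_EFinP.
  apply: filterS Kk => x Kx _; rewrite is_cvg_limn_einfE.
    by apply/esym/cvg_lim => //; apply/cvg_EFin; [exact: nearW|exact: Kx].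
  by apply/cvg_ex; exists (k x)%:E; apply/cvg_EFin; [exact: nearW|exact: Kx].
apply: le_trans (fatou mu measurableT mEK _) _; first by move=> m x _; rewrite lee_fin.
rewrite limn_einf_lim; apply: lime_le; first exact: is_cvg_einfs.
apply: nearW => m; apply: le_trans (Kc m); apply: ereal_inf_lbound.
by exists m => //=.
Qed.

(* Fatou's lemma applied to G m - F m. *)
Lemma pratt (F G : nat -> X -> R) (g : X -> R) (c e : R) :
  (forall m, measurable_fun setT (F m)) -> (forall m, measurable_fun setT (G m)) ->
  measurable_fun setT g ->
  (forall m x, 0 <= F m x) ->
  (forall m, {ae mu, forall x, F m x <= G m x}) ->
  {ae mu, forall x, F m x @[m --> \oo] --> (0 : R)} ->
  {ae mu, forall x, G m x @[m --> \oo] --> g x} ->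
  (forall m, (\int[mu]_x (G m x)%:E = c%:E)%E) -> (\int[mu]_x (g x)%:E = c%:E)%E ->
  0 < e -> ~ forall m, (e%:E <= \int[mu]_x (F m x)%:E)%E.
Proof.
move=> mF mG mg F0 FG cF cG iG ig e0 He.
have aeFG : {ae mu, forall x, forall m, F m x <= G m x} by exact: ae_foralln.
(* [F m <= G m] holds only almost everywhere; the absolute value makes the difference nonnegative at
   every point. *)
pose K m x := `|G m x - F m x|.
have mK m : measurable_fun setT (K m).
  by apply: measurableT_comp => //; exact: measurable_funB.
have KF m : (\int[mu]_x (K m x)%:E + \int[mu]_x (F m x)%:E = c%:E)%E.
  have mEK : measurable_fun setT (fun x => (K m x)%:E) by exact/measurable_EFinP.
  have mEF : measurable_fun setT (fun x => (F m x)%:E) by exact/measurable_EFinP.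
  rewrite -ge0_integralD//=; last 2 first.
  - by move=> x _; rewrite lee_fin normr_ge0.
  - by move=> x _; rewrite lee_fin F0.
  rewrite -(iG m); apply: ae_eq_integral => //.
  - exact: emeasurable_funD.
  - exact/measurable_EFinP.
  apply: filterS (FG m) => x Fx _; rewrite -EFinD /K ger0_norm ?subr_ge0//.
  by rewrite subrK.
(* The contradiction: Fatou's lemma loses e in the limit, whereas |g| equals g almost everywhere and
   has integral c. *)
have : (\int[mu]_x (`|g x|)%:E <= (c - e)%:E)%E.
  apply: (@fatou_ae K) => //.
  - exact: measurableT_comp.
  - by move=> m x; exact: normr_ge0.
  - apply: filterS2 cF cG => x Fx Gx; apply: cvg_norm.
    by rewrite -[g x]subr0; exact: cvgB.
  move=> m; have := KF m.
  have := He m; have : (0 <= \int[mu]_x (K m x)%:E)%E.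
    by apply: integral_ge0 => x _; rewrite lee_fin normr_ge0.
  case: (\int[mu]_x (K m x)%:E)%E => [a| |] //; case: (\int[mu]_x (F m x)%:E)%E => [b| |] //.
  by rewrite -EFinD !lee_fin => _ eb [<-]; lra.
have -> : (\int[mu]_x (`|g x|)%:E = \int[mu]_x (g x)%:E)%E.
  apply: ae_eq_integral => //.
  - by apply/measurable_EFinP; exact: measurableT_comp.
  - exact/measurable_EFinP.
  apply: filterS2 aeFG cG => x Fx Gx _; congr EFin; rewrite ger0_norm//.
  rewrite -(cvg_lim _ Gx)//; apply: limr_ge; first by apply/cvg_ex; exists (g x).
  by apply: nearW => m; exact: le_trans (F0 m x) (Fx m).
by rewrite ig lee_fin; lra.
Qed.
End Convergence.

(** * Complex-valued L_p functions *)

Section ComplexModulus.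
Context {R : realType}.
Implicit Types z w : R[i].

Lemma normc_ge0 z : 0 <= normc z.
Proof. by case: z => a b; exact: sqrtr_ge0. Qed.

Lemma normr_normc z : `|z| = (normc z)%:C.
Proof. by []. Qed.

Lemma normc_sum (I : Type) (s : seq I) (f : I -> R[i]) :
  normc (\sum_(i <- s) f i) <= \sum_(i <- s) normc (f i).
Proof.
elim: s => [|i s IH]; first by rewrite !big_nil normc0.
by rewrite !big_cons; apply: le_trans (le_normcD _ _) _; rewrite lerD2l.
Qed.

Lemma normc_prod (I : Type) (s : seq I) (f : I -> R[i]) :
  normc (\prod_(i <- s) f i) = \prod_(i <- s) normc (f i).
Proof.
elim: s => [|i s IH]; first by rewrite !big_nil normc1.
by rewrite !big_cons normcM IH.
Qed.

Lemma normcB z w : normc (z - w) = normc (w - z).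
Proof. by rewrite -normcN opprB. Qed.

Lemma normc_real (a : R) : normc a%:C = `|a|.
Proof. by rewrite /= expr0n /= addr0 sqrtr_sqr. Qed.

Lemma Re_le_normc z : `|complex.Re z| <= normc z.
Proof.
case: z => a b /=; rewrite -sqrtr_sqr ler_wsqrtr// lerDl.
exact: sqr_ge0.
Qed.

Lemma Im_le_normc z : `|complex.Im z| <= normc z.
Proof.
case: z => a b /=; rewrite -sqrtr_sqr ler_wsqrtr// lerDr.
exact: sqr_ge0.
Qed.

Lemma normc_le_ReIm z : normc z <= `|complex.Re z| + `|complex.Im z|.
Proof.
case: z => a b /=; rewrite -[X in _ <= X]ger0_norm ?addr_ge0// -sqrtr_sqr.
rewrite ler_wsqrtr// sqrrD !real_normK ?num_real// lerD2r lerDl.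
by rewrite mulrn_wge0// mulr_ge0.
Qed.

Lemma ReB z w : complex.Re (z - w) = complex.Re z - complex.Re w.
Proof. by case: z w => [? ?] [? ?]. Qed.

Lemma ImB z w : complex.Im (z - w) = complex.Im z - complex.Im w.
Proof. by case: z w => [? ?] [? ?]. Qed.

(** The norm of [R[i]] takes values in [R[i]], so its epsilons are complex numbers with zero
    imaginary part; this lemma trades them for real ones. *)
Lemma cvg_normcP (I : Type) (F : set_system I) (FF : Filter F) (f : I -> R[i]) (l : R[i]) :
  (f x @[x --> F] --> (l : R[i]^o)) <-> (normc (f x - l) @[x --> F] --> (0 : R)).
Proof.
split=> [H|/cvgrPdist_lt H].
  have {}H := (@cvgrPdist_lt R[i] R[i]^o _ F FF f l).1 H.
  apply/cvgrPdist_lt => e e0.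
  have := H e%:C; rewrite ltcR => /(_ e0); apply: filterS => x.
  by rewrite normr_normc ltcR normcB sub0r normrN ger0_norm ?normc_ge0.
apply: (@cvgrPdist_lt R[i] R[i]^o _ F FF f l).2 => e e0.
have [er e0'] : e = (complex.Re e)%:C /\ 0 < complex.Re e.
  by move: e0; case: e => a b; rewrite ltcE /= => /andP[/eqP -> ?].
have := H _ e0'; apply: filterS => x.
by rewrite er normr_normc ltcR normcB sub0r normrN ger0_norm ?normc_ge0.
Qed.

Lemma cvg_complex_ReIm (I : Type) (F : set_system I) (FF : Filter F)
    (f : I -> R[i]) (l : R[i]) :
  complex.Re (f x) @[x --> F] --> complex.Re l ->
  complex.Im (f x) @[x --> F] --> complex.Im l ->
  f x @[x --> F] --> (l : R[i]^o).
Proof.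
move=> /cvgrPdist_lt hr /cvgrPdist_lt hi; apply/cvg_normcP/cvgrPdist_lt => e e0.
have := hr (e / 2); have := hi (e / 2).
rewrite divr_gt0// => /(_ isT) {}hi /(_ isT) {}hr.
apply: filterS2 hr hi => x xr xi.
rewrite normcB sub0r normrN ger0_norm ?normc_ge0//.
apply: le_lt_trans (normc_le_ReIm _) _; rewrite [e]splitr.
by apply: ltrD; rewrite ?ReB ?ImB.
Qed.

End ComplexModulus.

Section ComplexIntegral.
Context {R : realType} {disp : measure_display} {X : measurableType disp}.
Variables (mu : probability X R).
Implicit Types (q : R) (f g : X -> R[i]).

(** The q-th power of the L_q norm. Without the root, pointwise bounds integrate directly; the price
    is the factor 2^q in [pint_triangle]. *)
Definition pint q f : \bar R := (\int[mu]_x (normc (f x) `^ q)%:E)%E.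

Lemma pint_ge0 q f : (0 <= pint q f)%E.
Proof. by apply: integral_ge0 => x _; rewrite lee_fin powR_ge0. Qed.

Lemma pintE q f : cLnorm mu q f = (pint q f `^ q^-1)%E.
Proof.
rewrite /cLnorm unlock /Lnorm /pint; congr (_ `^ _)%E.
by apply: eq_integral => x _ /=; rewrite ger0_norm// normc_ge0.
Qed.

Lemma measurable_normc_powR q f : cmeasurable f ->
  measurable_fun setT (fun x => normc (f x) `^ q).
Proof.
move=> mf; apply: (@measurableT_comp _ _ _ _ _ _ (@powR R ^~ q)) => //.
exact: measurable_normc.
Qed.

Lemma cmeasurableB f g : cmeasurable f -> cmeasurable g ->
  cmeasurable (fun x => f x - g x).
Proof.
move=> [fr fi] [gr gi]; split.
  rewrite (_ : (fun _ => _) = (fun x => complex.Re (f x) - complex.Re (g x))).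
    exact: measurable_funB.
  by apply/funext => x; case: (f x) (g x) => [? ?] [? ?].
rewrite (_ : (fun _ => _) = (fun x => complex.Im (f x) - complex.Im (g x))).
  exact: measurable_funB.
by apply/funext => x; case: (f x) (g x) => [? ?] [? ?].
Qed.

Lemma cmeasurableD f g : cmeasurable f -> cmeasurable g ->
  cmeasurable (fun x => f x + g x).
Proof.
move=> [fr fi] [gr gi]; split.
  rewrite (_ : (fun _ => _) = (fun x => complex.Re (f x) + complex.Re (g x))).
    exact: measurable_funD.
  by apply/funext => x; case: (f x) (g x) => [? ?] [? ?].
rewrite (_ : (fun _ => _) = (fun x => complex.Im (f x) + complex.Im (g x))).
  exact: measurable_funD.
by apply/funext => x; case: (f x) (g x) => [? ?] [? ?].
Qed.

Lemma cmeasurableM f g : cmeasurable f -> cmeasurable g ->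
  cmeasurable (fun x => f x * g x).
Proof.
move=> [fr fi] [gr gi]; split.
  rewrite (_ : (fun _ => _) = (fun x => complex.Re (f x) * complex.Re (g x)
      - complex.Im (f x) * complex.Im (g x))).
    by apply: measurable_funB; exact: measurable_funM.
  by apply/funext => x; case: (f x) (g x) => [? ?] [? ?].
rewrite (_ : (fun _ => _) = (fun x => complex.Re (f x) * complex.Im (g x)
    + complex.Im (f x) * complex.Re (g x))).
  by apply: measurable_funD; exact: measurable_funM.
by apply/funext => x; case: (f x) (g x) => [? ?] [? ?].
Qed.

Lemma cmeasurable_cst (c : R[i]) : cmeasurable (fun _ : X => c).
Proof. by split; exact: measurable_cst. Qed.

Lemma cmeasurable_sum (I : Type) (s : seq I) (h : I -> X -> R[i]) :
  (forall i, cmeasurable (h i)) -> cmeasurable (fun x => \sum_(i <- s) h i x).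
Proof.
move=> mh; elim: s => [|i s IH].
  by under eq_fun do rewrite big_nil; exact: cmeasurable_cst.
by under eq_fun do rewrite big_cons; exact: cmeasurableD.
Qed.

Lemma cmeasurable_prod (I : Type) (s : seq I) (h : I -> X -> R[i]) :
  (forall i, cmeasurable (h i)) -> cmeasurable (fun x => \prod_(i <- s) h i x).
Proof.
move=> mh; elim: s => [|i s IH].
  by under eq_fun do rewrite big_nil; exact: cmeasurable_cst.
by under eq_fun do rewrite big_cons; exact: cmeasurableM.
Qed.

Lemma cint_powR0_ae q f : 1 <= q -> cmeasurable f -> pint q f = 0%E ->
  {ae mu, forall x, f x = 0}.
Proof.
move=> q1 mf; rewrite /pint => f0.
have mfq : measurable_fun setT (fun x => (normc (f x) `^ q)%:E).
  by apply/measurable_EFinP; exact: measurable_normc_powR.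
have := (ae_eq_integral_abs mu measurableT mfq).1.
under eq_integral do rewrite gee0_abs ?lee_fin ?powR_ge0//.
move=> /(_ f0); apply: filterS => x /= /(_ I) [] /eqP.
by rewrite powR_eq0 => /andP[/eqP/eq0_normc].
Qed.

Lemma pint_ae_le q f g : 0 <= q -> cmeasurable f -> cmeasurable g ->
  {ae mu, forall x, normc (f x) <= normc (g x)} -> (pint q f <= pint q g)%E.
Proof.
move=> q0 mf mg fg; apply: ae_ge0_le_integral => //.
- by move=> x _; rewrite lee_fin powR_ge0.
- by apply/measurable_EFinP; exact: measurable_normc_powR.
- by move=> x _; rewrite lee_fin powR_ge0.
- by apply/measurable_EFinP; exact: measurable_normc_powR.
apply: filterS fg => x fgx _; rewrite lee_fin ge0_ler_powR ?nnegrE ?normc_ge0//.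
Qed.

Lemma pint_ae0 q f : 1 <= q -> cmeasurable f -> {ae mu, forall x, f x = 0} ->
  pint q f = 0%E.
Proof.
move=> q1 mf f0; apply/le_anti; rewrite pint_ge0 andbT.
have q0 : 0 < q by exact: lt_le_trans q1.
apply: le_trans (@pint_ae_le q f (fun=> 0) (ltW q0) mf (cmeasurable_cst 0) _) _.
  by apply: filterS f0 => x ->.
by rewrite /pint; under eq_integral do rewrite normc0 powR0 ?gt_eqF//; rewrite integral0.
Qed.

Lemma pint_triangle q f g : 1 <= q -> cmeasurable f -> cmeasurable g ->
  (pint q (fun x => f x + g x)%R <= (2 `^ q)%:E * (pint q f + pint q g))%E.
Proof.
move=> q1 mf mg; have q0 : 0 < q by exact: lt_le_trans q1.
rewrite /pint -ge0_integralD//; last 4 first.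
- by move=> x _; rewrite lee_fin powR_ge0.
- by apply/measurable_EFinP; exact: measurable_normc_powR.
- by move=> x _; rewrite lee_fin powR_ge0.
- by apply/measurable_EFinP; exact: measurable_normc_powR.
rewrite -ge0_integralZl_EFin ?powR_ge0//; last 2 first.
- by move=> x _; rewrite -EFinD lee_fin addr_ge0 ?powR_ge0.
- by apply: emeasurable_funD; apply/measurable_EFinP; exact: measurable_normc_powR.
apply: ge0_le_integral => //.
- by move=> x _; rewrite lee_fin powR_ge0.
- by apply/measurable_EFinP; apply: measurable_normc_powR; exact: cmeasurableD.
- apply: emeasurable_funM => //.
  by apply: emeasurable_funD; apply/measurable_EFinP; exact: measurable_normc_powR.
move=> x _; rewrite -EFinD -EFinM lee_fin.
apply: le_trans (powRD_le q1 (normc_ge0 _) (normc_ge0 _)).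
by rewrite ge0_ler_powR ?(ltW q0) ?nnegrE ?addr_ge0 ?normc_ge0// le_normcD.
Qed.

Lemma cvge0_leP (I : Type) (F : set_system I) (FF : Filter F) (u : I -> \bar R) :
  (forall i, (0 <= u i)%E) ->
  (u i @[i --> F] --> 0%E) <-> (forall e : R, 0 < e -> \forall i \near F, (u i <= e%:E)%E).
Proof.
move=> u0; split.
  move=> /fine_cvgP[uf /cvgrPdist_le H] e e0.
  apply: filterS2 uf (H e e0) => i ui.
  rewrite sub0r normrN ger0_norm ?fine_ge0//= => h.
  by rewrite -(fineK ui) lee_fin.
move=> H; apply/fine_cvgP; split.
  by apply: filterS (H 1 ltr01) => i ui; rewrite ge0_fin_numE// (le_lt_trans ui) ?ltry.
apply/cvgrPdist_le => e e0; apply: filterS (H e e0) => i ui.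
rewrite sub0r normrN ger0_norm ?fine_ge0//=.
by rewrite -lee_fin fineK// ge0_fin_numE// (le_lt_trans ui) ?ltry.
Qed.

Lemma cLnorm_cvg0P q (I : Type) (F : set_system I) (FF : Filter F) (f : I -> X -> R[i]) :
  1 <= q ->
  (cLnorm mu q (f i) @[i --> F] --> 0%E) <-> (pint q (f i) @[i --> F] --> 0%E).
Proof.
move=> q1; have q0 : 0 < q by exact: lt_le_trans q1.
have pq i : pint q (f i) = (cLnorm mu q (f i) `^ q)%E.
  by rewrite pintE -poweRrM mulVf ?gt_eqF// poweRe1// pint_ge0.
have c0 i : (0 <= cLnorm mu q (f i))%E by rewrite pintE poweR_ge0.
rewrite !cvge0_leP//; last by move=> i; exact: pint_ge0.
split=> H e e0.
  apply: filterS (H (e `^ q^-1) _); last exact: powR_gt0.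
  move=> i hi; rewrite pq -[e%:E]poweRe1 ?lee_fin ?(ltW e0)//.
  rewrite -[X in (_ <= _ `^ X)%E](@mulVf _ q) ?gt_eqF// poweRrM.
  apply: gt0_ler_poweR; rewrite ?(ltW q0) ?in_itv/= ?leey ?andbT//.
  by rewrite lee_fin powR_ge0.
apply: filterS (H (e `^ q) _); last exact: powR_gt0.
move=> i hi; rewrite pintE -[e%:E]poweRe1 ?lee_fin ?(ltW e0)//.
rewrite -[X in (_ <= _ `^ X)%E](@mulfV _ q) ?gt_eqF// poweRrM.
apply: gt0_ler_poweR; rewrite ?invr_ge0 ?(ltW q0) ?in_itv/= ?leey ?andbT ?pint_ge0//.
by rewrite lee_fin powR_ge0.
Qed.

Lemma cLfunP q f : 1 <= q ->
  f \in cLfun mu q <-> cmeasurable f /\ (pint q f < +oo)%E.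
Proof.
move=> q1; have q0 : 0 < q by exact: lt_le_trans q1.
have q'0 : 0 < q^-1 by rewrite invr_gt0.
split=> [/asboolP[mf]|[mf lf]].
  rewrite pintE => /lty_poweRy; rewrite gt_eqF// => /(_ isT) ?; by split.
by apply/asboolP; split=> //; rewrite pintE; exact: poweR_lty.
Qed.

End ComplexIntegral.

Section PowerLimit.
Context {R : realType}.

Lemma cvg_powRl (I : Type) (F : set_system I) (FF : Filter F) (u : I -> R) (l q : R) :
  0 < q -> (forall i, 0 <= u i) -> 0 <= l ->
  u i @[i --> F] --> l -> u i `^ q @[i --> F] --> l `^ q.
Proof.
move=> q0 u0; rewrite le_eqVlt => /predU1P[<-|l0] ul.
  rewrite powR0 ?gt_eqF//; apply/cvgrPdist_le => e e0.
  have e'0 : 0 < e `^ q^-1 by exact: powR_gt0.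
  move/cvgrPdist_le : ul => /(_ _ e'0); apply: filterS => i.
  rewrite !sub0r !normrN !ger0_norm ?powR_ge0// => h.
  rewrite -[e]powRr1 ?(ltW e0)// -(@mulVf _ q) ?gt_eqF// powRrM.
  by rewrite ge0_ler_powR ?nnegrE ?powR_ge0 ?(ltW q0).
(* The exponential form is valid away from 0 only; u is eventually positive because l is, and the
   limit 0 was treated separately. *)
have ne (a : R) : 0 < a -> a `^ q = expR (q * ln a) by move=> a0; rewrite /powR gt_eqF.
rewrite ne//.
apply: (@cvg_trans _ (expR (q * ln (u i)) @[i --> F])).
  apply: near_eq_cvg; move/cvgrPdist_lt : (ul) => /(_ _ l0).
  apply: filterS => i; rewrite ltr_distlC subrr => /andP[ui _]; exact: (esym (ne _ ui)).
apply: (@cvg_comp _ _ _ (fun i => q * ln (u i)) expR); last exact: continuous_expR.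
apply: cvgM; first exact: cvg_cst.
exact: (cvg_comp u (@ln R) ul (@continuous_ln R l l0)).
Qed.

End PowerLimit.

Section LpSeminorm.
Context {R : realType} {disp : measure_display} {X : measurableType disp}.
Variables (mu : probability X R) (p : R) (p1 : 1 <= p).
Implicit Types f g : cLp mu p1.

Let p0 : 0 < p. Proof. exact: lt_le_trans p1. Qed.

Lemma cLp_cmeasurable f : cmeasurable f.
Proof. by have /asboolP[] := valP f. Qed.

Lemma cLp_pint_lty f : (pint mu p f < +oo)%E.
Proof. by have /(cLfunP mu _ p1)[] := valP f. Qed.

Lemma pint_cLp f : pint mu p f = ((cLp_norm f) `^ p)%:E.
Proof.
rewrite /cLp_norm pintE fine_poweR -powRrM mulVf ?gt_eqF// powRr1.
  by rewrite fineK// ge0_fin_numE ?pint_ge0// cLp_pint_lty.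
by rewrite fine_ge0// pint_ge0.
Qed.

Lemma cLp_norm_ge0 f : 0 <= cLp_norm f.
Proof. by rewrite /cLp_norm fine_ge0// pintE poweR_ge0. Qed.

Lemma cLp_norm0P f : cLp_norm f = 0 <-> {ae mu, forall x, f x = 0}.
Proof.
split=> [f0|f0].
  by apply: (cint_powR0_ae p1 (cLp_cmeasurable f)); rewrite pint_cLp f0 powR0// gt_eqF.
have := pint_ae0 p1 (cLp_cmeasurable f) f0; rewrite pint_cLp => -[] /eqP.
by rewrite powR_eq0 => /andP[/eqP].
Qed.

Lemma le_cLp_norm f g : (pint mu p f <= pint mu p g)%E -> cLp_norm f <= cLp_norm g.
Proof.
rewrite !pint_cLp lee_fin => h; rewrite leNgt; apply/negP => gf.
by move: h; rewrite leNgt gt0_ltr_powR ?nnegrE ?cLp_norm_ge0.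
Qed.

(** On a probability space L_p is contained in L_1, by the pointwise bound |f| <= 1 + |f|^p. *)
Lemma integrable_le_normc (u : X -> R) f : measurable_fun setT u ->
  (forall x, `|u x| <= normc (f x)) -> mu.-integrable setT (EFin \o u).
Proof.
move=> mu_ uf.
have i1 : mu.-integrable setT (fun x => (1 + normc (f x) `^ p)%:E).
  under eq_fun do rewrite EFinD.
  apply: integrableD => //; first exact: finite_measure_integrable_cst.
  apply/integrableP; split.
    by apply/measurable_EFinP; exact: measurable_normc_powR (cLp_cmeasurable f).
  under eq_integral do rewrite gee0_abs ?lee_fin ?powR_ge0//.
  exact: cLp_pint_lty.
apply: (le_integrable measurableT _ _ i1); first exact/measurable_EFinP.
move=> x _; rewrite lee_fin; apply: le_trans (uf x) _.
apply: le_trans (le_1DpowR p1 (normc_ge0 _)) _; exact: ler_norm.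
Qed.

Lemma integrable_Re f : mu.-integrable setT (EFin \o (fun x => complex.Re (f x))).
Proof.
apply: (integrable_le_normc (f := f)) => [|x]; last exact: Re_le_normc.
by case: (cLp_cmeasurable f).
Qed.

Lemma integrable_Im f : mu.-integrable setT (EFin \o (fun x => complex.Im (f x))).
Proof.
apply: (integrable_le_normc (f := f)) => [|x]; last exact: Im_le_normc.
by case: (cLp_cmeasurable f).
Qed.

End LpSeminorm.

Section ComplexBirkhoff.
Context {R : realType} {disp : measure_display} {X : measurableType disp}.
Variables (mu : probability X R) (T : X -> X) (hT : measure_preserving mu T).

Definition cavg (f : X -> R[i]) n x : R[i] :=
  n%:R^-1 * \sum_(k < n) f (iter k T x).

Lemma Re_sum (I : Type) (s : seq I) (f : I -> R[i]) :
  complex.Re (\sum_(i <- s) f i) = \sum_(i <- s) complex.Re (f i).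
Proof.
elim: s => [|i s IH]; first by rewrite !big_nil.
by rewrite !big_cons -IH; case: (f i) (\sum_(i <- s) f i) => [? ?] [? ?].
Qed.

Lemma Im_sum (I : Type) (s : seq I) (f : I -> R[i]) :
  complex.Im (\sum_(i <- s) f i) = \sum_(i <- s) complex.Im (f i).
Proof.
elim: s => [|i s IH]; first by rewrite !big_nil.
by rewrite !big_cons -IH; case: (f i) (\sum_(i <- s) f i) => [? ?] [? ?].
Qed.

Lemma natV_complex n : (n%:R^-1 : R[i]) = (n%:R^-1)%:C.
Proof. by rewrite -[n%:R in LHS](rmorph_nat (real_complex R)) fmorphV. Qed.

Lemma Re_cavg f n x :
  complex.Re (cavg f n x) = birkhoff_avg T (fun y => complex.Re (f y)) n x.
Proof.
rewrite /cavg /birkhoff_avg /birkhoff_sum natV_complex -Re_sum.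
by case: (\sum_(k < n) _) => a b /=; rewrite mul0r subr0.
Qed.

Lemma Im_cavg f n x :
  complex.Im (cavg f n x) = birkhoff_avg T (fun y => complex.Im (f y)) n x.
Proof.
rewrite /cavg /birkhoff_avg /birkhoff_sum natV_complex -Im_sum.
by case: (\sum_(k < n) _) => a b /=; rewrite mul0r addr0.
Qed.

Lemma normc_cavg (q : R) f n x : 1 <= q -> (0 < n)%N ->
  normc (cavg f n x) `^ q <= birkhoff_avg T (fun y => normc (f y) `^ q) n x.
Proof.
move=> q1 n0; have q0 : 0 < q by exact: lt_le_trans q1.
rewrite /cavg normcM natV_complex normc_real ger0_norm ?invr_ge0//.
apply: (@le_trans _ _ ((\sum_(k < n) n%:R^-1 * normc (f (iter k T x))) `^ q)).
  rewrite ge0_ler_powR ?(ltW q0) ?nnegrE//.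
  - by rewrite mulr_ge0 ?invr_ge0// normc_ge0.
  - by apply: sumr_ge0 => k _; rewrite mulr_ge0 ?invr_ge0// normc_ge0.
  by rewrite -mulr_sumr ler_wpM2l ?invr_ge0//; exact: normc_sum.
rewrite /birkhoff_avg /birkhoff_sum mulr_sumr.
apply: jensen_powR => //.
- by move=> i; exact: normc_ge0.
by rewrite sumr_const card_ord -[X in X <= _]mulr_natl mulfV// pnatr_eq0 -lt0n.
Qed.

Lemma sume_const n (c : \bar R) : (0 <= c)%E ->
  (\sum_(k < n) c = n%:R%:E * c)%E.
Proof.
move=> c0; elim: n => [|n IH]; first by rewrite big_ord0 mul0e.
by rewrite big_ord_recr /= IH -natr1 EFinD ge0_muleDl// ?lee_fin// mul1e.
Qed.

(** Every iterate of T preserves mu. The independence of n is what [pratt] requires of the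
    dominating functions. *)
Lemma integral_birkhoff_avg (h : X -> R) n : (0 < n)%N ->
  measurable_fun setT h -> (forall x, 0 <= h x) ->
  (\int[mu]_x (birkhoff_avg T h n x)%:E = \int[mu]_x (h x)%:E)%E.
Proof.
move=> n0 mh h0.
have mhk k : measurable_fun setT (fun x => (h (iter k T x))%:E).
  apply/measurable_EFinP.
  exact: (measurableT_comp mh (measurable_mp (measure_preserving_iter k hT))).
under eq_integral do rewrite /birkhoff_avg EFinM.
rewrite ge0_integralZl_EFin ?invr_ge0//; last 2 first.
- by move=> x _; rewrite lee_fin sumr_ge0.
- by apply/measurable_EFinP; exact: (measurable_birkhoff_sum hT).
under eq_integral do rewrite /birkhoff_sum -sumEFin.
rewrite ge0_integral_sum//; last by move=> k x _; rewrite lee_fin.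
under eq_bigr => k _.
  rewrite (@ge0_integral_mp _ _ _ _ _ (measure_preserving_iter k hT) (EFin \o h)); last 2 first.
  - exact/measurable_EFinP.
  - by move=> x; rewrite lee_fin.
  over.
rewrite sume_const ?integral_ge0//; last by move=> x _; rewrite lee_fin.
rewrite muleA -EFinM mulVf ?mul1e//.
by rewrite pnatr_eq0 -lt0n.
Qed.

Lemma cmeasurable_cavg f n : cmeasurable f -> cmeasurable (cavg f n).
Proof.
move=> [mr mi]; apply: cmeasurableM; first exact: cmeasurable_cst.
apply: cmeasurable_sum => k.
by split; [apply: (measurableT_comp mr)|apply: (measurableT_comp mi)];
  exact: (measurable_mp (measure_preserving_iter k hT)).
Qed.

Lemma pint_cavg (q : R) f n : 1 <= q -> (0 < n)%N -> cmeasurable f ->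
  (pint mu q (cavg f n) <= pint mu q f)%E.
Proof.
move=> q1 n0 mf.
rewrite /pint -(integral_birkhoff_avg n0 (measurable_normc_powR q mf)); last first.
  by move=> x; exact: powR_ge0.
apply: ge0_le_integral => //.
- by move=> x _; rewrite lee_fin powR_ge0.
- apply/measurable_EFinP; apply: measurable_normc_powR.
  exact: cmeasurable_cavg.
- apply/measurable_EFinP; apply: measurable_funM => //.
  by apply: (measurable_birkhoff_sum hT); exact: measurable_normc_powR.
by move=> x _; rewrite lee_fin normc_cavg.
Qed.

Lemma birkhoff_complex (f g : X -> R[i]) :
  mu.-integrable setT (fun x => (complex.Re (f x))%:E) ->
  mu.-integrable setT (fun x => (complex.Im (f x))%:E) ->
  is_cond_exp mu (invariant_sets T) f g ->
  {ae mu, forall x, cavg f n x @[n --> \oo] --> (g x : R[i]^o)}.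
Proof.
move=> ifr ifi [Gg igr igi gf].
(* [cintegral] consists of real numbers, an infinite integral being sent to 0; integrability lifts
   its equalities to the extended reals. *)
have fineE (u v : X -> R) A : measurable A -> mu.-integrable setT (EFin \o u) ->
    mu.-integrable setT (EFin \o v) ->
    \int[mu]_(x in A) u x = \int[mu]_(x in A) v x ->
    (\int[mu]_(x in A) (u x)%:E = \int[mu]_(x in A) (v x)%:E)%E.
  move=> mA iu iv; rewrite /Rintegral => E.
  rewrite -[LHS]fineK ?E ?fineK//; apply: integrable_fin_num => //;
    exact: (integrableS measurableT).
have Hr : {ae mu, forall x, birkhoff_avg T (fun y => complex.Re (f y)) n x
    @[n --> \oo] --> complex.Re (g x)}.
  apply: (birkhoff hT) => //.
    by apply: (@invariant_fun _ _ _ _ (fun x => complex.Re (g x))) => B /Gg[].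
  move=> A [mA TA]; apply: fineE => //.
  by have [] := gf A (conj mA TA).
have Hi : {ae mu, forall x, birkhoff_avg T (fun y => complex.Im (f y)) n x
    @[n --> \oo] --> complex.Im (g x)}.
  apply: (birkhoff hT) => //.
    by apply: (@invariant_fun _ _ _ _ (fun x => complex.Im (g x))) => B /Gg[].
  move=> A [mA TA]; apply: fineE => //.
  by have [] := gf A (conj mA TA).
apply: filterS2 Hr Hi => x hr hi; apply: cvg_complex_ReIm.
- by under eq_fun do rewrite Re_cavg.
- by under eq_fun do rewrite Im_cavg.
Qed.

(** Contraction of the conditional expectation in L_q without a conditional Jensen inequality: g is
    an almost everywhere limit of averages whose q-th moments are at most that of f, and Fatou's
    lemma passes to the limit. *)
Lemma pint_cond_exp (q : R) (f g : X -> R[i]) : 1 <= q -> cmeasurable f -> cmeasurable g ->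
  {ae mu, forall x, cavg f n x @[n --> \oo] --> (g x : R[i]^o)} ->
  (pint mu q g <= pint mu q f)%E.
Proof.
move=> q1 mf mg fg; have q0 : 0 < q by exact: lt_le_trans q1.
have mavg n : cmeasurable (cavg f n) by exact: cmeasurable_cavg.
(* The shift of the index is due to [pint_cavg], which concerns averages of at least one term. *)
apply: (@fatou_ae _ _ _ _ (fun n x => normc (cavg f n.+1 x) `^ q)).
- by move=> n; exact: measurable_normc_powR.
- exact: measurable_normc_powR.
- by move=> n x; exact: powR_ge0.
- apply: filterS fg => x /cvg_normcP h.
  have {}h : normc (cavg f n x) @[n --> \oo] --> normc (g x).
    apply/cvgrPdist_le => e e0; move/cvgrPdist_le : h => /(_ e e0).
    apply: filterS => n; rewrite sub0r normrN ger0_norm ?normc_ge0// => h.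
    apply: le_trans _ h; rewrite distrC ler_norml lerBlDr lerNl opprB lerBlDr.
    rewrite andbC -{1}[cavg f n x](subrK (g x)) le_normcD/= normcB.
    by rewrite -{1}[g x](subrK (cavg f n x)) le_normcD.
  have hS : normc (cavg f n.+1 x) @[n --> \oo] --> normc (g x).
    by rewrite (cvg_shiftS (fun n => normc (cavg f n x))).
  by apply: cvg_powRl => // *; exact: normc_ge0.
by move=> n; exact: pint_cavg.
Qed.

End ComplexBirkhoff.

Section ComplexLimits.
Context {R : realType} {I : Type} (F : set_system I) {FF : Filter F}.
Implicit Types (f g : I -> R[i]) (a b : R[i]).

Lemma cvgCD f g a b : f i @[i --> F] --> (a : R[i]^o) ->
  g i @[i --> F] --> (b : R[i]^o) -> f i + g i @[i --> F] --> (a + b : R[i]^o).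
Proof. exact: (@cvgD R[i] R[i]^o). Qed.

Lemma cvgCM f g a b : f i @[i --> F] --> (a : R[i]^o) ->
  g i @[i --> F] --> (b : R[i]^o) -> f i * g i @[i --> F] --> (a * b : R[i]^o).
Proof. exact: (@cvgM R[i]). Qed.

Lemma cvgC_cst a : a @[_ --> F] --> (a : R[i]^o).
Proof. exact: (@cvg_cst R[i]^o). Qed.

Lemma cvgC_prod (J : Type) (s : seq J) (f : J -> I -> R[i]) (a : J -> R[i]) :
  (forall j, f j i @[i --> F] --> (a j : R[i]^o)) ->
  \prod_(j <- s) f j i @[i --> F] --> ((\prod_(j <- s) a j) : R[i]^o).
Proof.
move=> fa; elim: s => [|j s IH].
  by under eq_fun do rewrite big_nil; rewrite big_nil; exact: cvgC_cst.
rewrite big_cons; under eq_fun do rewrite big_cons.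
exact: (cvgCM (fa j) IH).
Qed.

End ComplexLimits.

Section LpOperators.
Context {R : realType} {disp : measure_display} {X : measurableType disp}.
Variables (mu : probability X R) (T : X -> X) (hT : measure_preserving mu T).
Variables (p : R) (p1 : 1 <= p).
Implicit Types f g : cLp mu p1.

Lemma cLp_funD f g x : (f + g) x = f x + g x. Proof. by []. Qed.

Lemma cLp_funB f g x : (f - g) x = f x - g x. Proof. by []. Qed.

Lemma cLp_funZ (a : R[i]) f x : (a *: f) x = a * f x. Proof. by []. Qed.

Lemma koopmanD k f g : koopman hT k (f + g) = koopman hT k f + koopman hT k g.
Proof. exact: val_inj. Qed.

Lemma koopmanZ k a f : koopman hT k (a *: f) = a *: koopman hT k f.
Proof. exact: val_inj. Qed.

Lemma koopmanB k f g : koopman hT k (f - g) = koopman hT k f - koopman hT k g.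
Proof. exact: val_inj. Qed.

Lemma pint_koopman k f : pint mu p (koopman hT k f) = pint mu p f.
Proof.
have mf := measurable_normc_powR p (cLp_cmeasurable f).
apply: (@ge0_integral_mp _ _ _ _ _ (measure_preserving_iter k hT)
  (fun x => (normc (f x) `^ p)%:E)); first exact/measurable_EFinP.
by move=> x; rewrite lee_fin powR_ge0.
Qed.

Lemma cLp_norm_koopman k f : cLp_norm (koopman hT k f) = cLp_norm f.
Proof. by rewrite /cLp_norm !pintE pint_koopman. Qed.

(** The default in [E_inv] is not taken: conditional expectations of the real and imaginary parts
    form a version g, and g lies in L_p because Birkhoff's theorem exhibits it as a limit of
    averages of f. *)
Lemma E_inv_cond_exp f : is_cond_exp mu (invariant_sets T) f (E_inv T f).
Proof.
rewrite /E_inv; case: xgetP => [g _ //|] /= nex; exfalso.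
have ir := integrable_Re f; have ii := integrable_Im f.
have [gr [Gr igr Er]] := @invariant_cond_exp_exists _ _ _ mu T _ ir.
have [gi [Gi igi Ei]] := @invariant_cond_exp_exists _ _ _ mu T _ ii.
pose g x := gr x +i* gi x.
have cg : is_cond_exp mu (invariant_sets T) f g.
  split=> //=; first by move=> B mB; split; [exact: Gr|exact: Gi].
  by move=> A GA; rewrite /cintegral /Rintegral /= Er// Ei.
have mg : cmeasurable g.
  by split; apply/measurable_EFinP; [exact: measurable_int igr|exact: measurable_int igi].
have gL : g \in cLfun mu p.
  apply/cLfunP => //; split=> //; apply: le_lt_trans (cLp_pint_lty f).
  apply: (pint_cond_exp hT) => //; first exact: cLp_cmeasurable.
  exact: (birkhoff_complex hT).
by apply: (nex (CLp p1 gL)).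
Qed.

Lemma birkhoff_cLp f :
  {ae mu, forall x, cavg T f n x @[n --> \oo] --> (E_inv T f x : R[i]^o)}.
Proof.
apply: (birkhoff_complex hT); [exact: integrable_Re|exact: integrable_Im|].
exact: E_inv_cond_exp.
Qed.

Lemma cLp_norm_E_inv f : cLp_norm (E_inv T f) <= cLp_norm f.
Proof.
apply: le_cLp_norm; apply: (pint_cond_exp hT) => //; try exact: cLp_cmeasurable.
exact: birkhoff_cLp.
Qed.

Lemma cavgD (f g : X -> R[i]) n x :
  cavg T (fun y => f y + g y) n x = cavg T f n x + cavg T g n x.
Proof. by rewrite /cavg big_split mulrDr. Qed.

Lemma cavgZ (a : R[i]) (f : X -> R[i]) n x :
  cavg T (fun y => a * f y) n x = a * cavg T f n x.
Proof. by rewrite /cavg -mulr_sumr mulrCA. Qed.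

Lemma cvgC_unique (u : nat -> R[i]) (a b : R[i]) :
  u n @[n --> \oo] --> (a : R[i]^o) -> u n @[n --> \oo] --> (b : R[i]^o) -> a = b.
Proof.
by move=> ua ub; exact: (@cvg_unique R[i]^o _ (u n @[n --> \oo]) _ a b ua ub).
Qed.

(** The averages are exactly additive, so the versions chosen for f, g and f + g are related by
    uniqueness of pointwise limits. *)
Lemma E_invD f g : cLp_norm (E_inv T (f + g) - (E_inv T f + E_inv T g)) = 0.
Proof.
apply/cLp_norm0P; have := birkhoff_cLp (f + g).
apply: filterS3 (birkhoff_cLp f) (birkhoff_cLp g) => x hf hg hfg.
rewrite cLp_funB cLp_funD; apply/eqP; rewrite subr_eq0; apply/eqP.
apply: cvgC_unique hfg _; under eq_fun do rewrite cavgD.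
exact: (cvgCD hf hg).
Qed.

Lemma E_invZ a f : cLp_norm (E_inv T (a *: f) - a *: E_inv T f) = 0.
Proof.
apply/cLp_norm0P; have := birkhoff_cLp (a *: f).
apply: filterS2 (birkhoff_cLp f) => x hf hfg.
rewrite cLp_funB cLp_funZ; apply/eqP; rewrite subr_eq0; apply/eqP.
apply: cvgC_unique hfg _; under eq_fun do rewrite cavgZ.
exact: (cvgCM (@cvgC_cst R nat \oo _ a) hf).
Qed.

Lemma E_inv_null f g : cLp_norm (f - g) = 0 -> cLp_norm (E_inv T f - E_inv T g) = 0.
Proof.
move=> fg0; have h0 : cLp_norm (E_inv T (f - g)) = 0.
  by apply/le_anti; rewrite cLp_norm_ge0 andbT -fg0 cLp_norm_E_inv.
apply/cLp_norm0P; move/cLp_norm0P : h0; have := E_invD (f - g) g.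
move/cLp_norm0P; apply: filterS2 => x.
rewrite subrK !cLp_funB cLp_funD => /eqP; rewrite subr_eq0 => /eqP -> ->.
by rewrite add0r subrr.
Qed.

End LpOperators.

Section Diagonal.
Context {R : realType} {disp : measure_display} {X : measurableType disp}.
Variables (mu : probability X R) (p : R) (p1 : 1 <= p) (d : nat).
Notation V := (cLp mu p1).
Notation N := (@cLp_norm R disp X mu p p1).
Notation tensor := (@formal_tensor R V d).

Lemma formal_diag_cat (u v : tensor) x :
  formal_diag (u ++ v) x = formal_diag u x + formal_diag v x.
Proof. exact: big_cat. Qed.

Lemma formal_diag_scale a (u : tensor) x :
  formal_diag (formal_scale a u) x = a * formal_diag u x.
Proof.
rewrite /formal_diag /formal_scale big_map mulr_sumr.
by apply: eq_bigr => ct _; rewrite mulrA.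
Qed.

Lemma formal_diag_sub (u v : tensor) x :
  formal_diag (formal_sub u v) x = formal_diag u x - formal_diag v x.
Proof. by rewrite formal_diag_cat formal_diag_scale mulN1r. Qed.

Lemma cmeasurable_diag (u : tensor) : cmeasurable (formal_diag u).
Proof.
apply: cmeasurable_sum => ct; apply: cmeasurableM; first exact: cmeasurable_cst.
by apply: cmeasurable_prod => i; exact: cLp_cmeasurable.
Qed.

Lemma prod_upd (t : 'I_d -> V) i (y : V) x :
  \prod_j upd t i y j x = y x * \prod_(j | j != i) t j x.
Proof.
rewrite (bigD1 i)//= /upd eqxx; congr (_ * _).
by apply: eq_bigr => j /negbTE ->.
Qed.

(** The diagonal may be negligible for mu^d, so the restriction has to be read off from the
    representing tensors. Induction over the multilinearity relations shows that the representation
    does not matter; among the relations that are not closure rules, only [tensor_slot_null] costs a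
    null set. *)
Lemma formal_diag_eq (u v : tensor) : tensor_eq N u v ->
  {ae mu, forall x, formal_diag u x = formal_diag v x}.
Proof.
elim=> {u v}.
- by move=> u; exact: aeW.
- by move=> u v _; apply: filterS.
- by move=> u v w _ h1 _ h2; apply: filterS2 h1 h2 => x -> ->.
- move=> u u' v v' _ h1 _ h2; apply: filterS2 h1 h2 => x.
  by rewrite !formal_diag_cat => -> ->.
- by move=> u v; apply: aeW => x; rewrite !formal_diag_cat addrC.
- by move=> t; apply: aeW => x; rewrite /formal_diag big_seq1 big_nil mul0r.
- move=> a b t; apply: aeW => x.
  by rewrite /formal_diag big_seq1 !big_cons big_nil addr0 mulrDl.
- move=> c t i y z; apply: aeW => x.
  rewrite /formal_diag big_seq1 !big_cons big_nil addr0 /= !prod_upd.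
  by rewrite cLp_funD mulrDl mulrDr.
- move=> c t i a y; apply: aeW => x.
  by rewrite /formal_diag !big_seq1 /= !prod_upd cLp_funZ !mulrA.
- move=> c t i y z /cLp_norm0P; apply: filterS => x.
  rewrite cLp_funB => /eqP; rewrite subr_eq0 => /eqP yz.
  by rewrite /formal_diag !big_seq1 /= !prod_upd yz.
Qed.

End Diagonal.

(** * Projective tensor powers *)

Section TensorPower.
Context {R : realType} {V : lmodType R[i]} (N : V -> R) (d : nat).
Hypothesis N0 : forall x, 0 <= N x.
Notation tensor := (@formal_tensor R V d).
Implicit Types (u v w : tensor) (A : 'I_d -> V -> V).

(* Linearity is only required up to N-null elements: E_inv is an arbitrary
   version of the conditional expectation, chosen separately for each function. *)
Record null_contraction (B : V -> V) : Prop := NullContraction {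
  ncD : forall x y, N (B (x + y) - (B x + B y)) = 0;
  ncZ : forall a x, N (B (a *: x) - a *: B x) = 0;
  nc_null : forall x y, N (x - y) = 0 -> N (B x - B y) = 0;
  nc_le : forall x, N (B x) <= N x }.

Lemma formal_cost_ge0 u : 0 <= formal_cost N u.
Proof.
by apply: sumr_ge0 => ct _; rewrite mulr_ge0 ?normc_ge0 ?prodr_ge0.
Qed.

Lemma formal_cost_cat u v : formal_cost N (u ++ v) = formal_cost N u + formal_cost N v.
Proof. exact: big_cat. Qed.

Lemma proj_norm_has_inf u : has_inf [set formal_cost N v | v in tensor_eq N u].
Proof.
split; first by exists (formal_cost N u); exists u => //; exact: tensor_refl.
by exists 0 => _ [v _ <-]; exact: formal_cost_ge0.
Qed.

Lemma proj_norm_le u v : tensor_eq N u v -> proj_norm N u <= formal_cost N v.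
Proof.
move=> uv; apply: ge_inf; first by case: (proj_norm_has_inf u).
by exists v.
Qed.

Lemma proj_norm_ge0 u : 0 <= proj_norm N u.
Proof.
apply: lb_le_inf; first by case: (proj_norm_has_inf u).
by move=> _ [v _ <-]; exact: formal_cost_ge0.
Qed.

Lemma proj_norm_lt u e : proj_norm N u < e ->
  exists2 v, tensor_eq N u v & formal_cost N v < e.
Proof.
move=> ue; have e0 : 0 < e - proj_norm N u by rewrite subr_gt0.
have [_ [v uv <-]] := inf_adherent e0 (proj_norm_has_inf u).
by rewrite -/(proj_norm N u) subrKC => ve; exists v.
Qed.

Lemma formal_map_cat A u v : formal_map A (u ++ v) = formal_map A u ++ formal_map A v.
Proof. exact: map_cat. Qed.

Lemma formal_map_scale A a u :
  formal_map A (formal_scale a u) = formal_scale a (formal_map A u).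
Proof. by rewrite /formal_map /formal_scale -!map_comp. Qed.

Lemma formal_map_sub A u v :
  formal_map A (formal_sub u v) = formal_sub (formal_map A u) (formal_map A v).
Proof. by rewrite formal_map_cat formal_map_scale. Qed.

Lemma formal_map_upd A t i y :
  (fun j => A j (upd t i y j)) = upd (fun j => A j (t j)) i (A i y).
Proof. by apply/funext => j; rewrite /upd; case: eqP => [->|]. Qed.

Lemma tensor_eq_map A u v : (forall i, null_contraction (A i)) ->
  tensor_eq N u v -> tensor_eq N (formal_map A u) (formal_map A v).
Proof.
move=> hA; elim=> {u v}.
- by move=> u; exact: tensor_refl.
- by move=> u v _; exact: tensor_sym.
- by move=> u v w _ h1 _; exact: tensor_trans.
- by move=> u u' v v' _ h1 _ h2; rewrite !formal_map_cat; exact: tensor_cat.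
- by move=> u v; rewrite !formal_map_cat; exact: tensor_catC.
- by move=> t; exact: tensor_coef0.
- by move=> a b t; exact: tensor_coefD.
- move=> c t i x y; rewrite /formal_map /= !formal_map_upd.
  apply: tensor_trans (tensor_slotD _ _ _ _ _ _).
  by apply: tensor_slot_null; exact: ncD.
- move=> c t i a x; rewrite /formal_map /= !formal_map_upd.
  apply: tensor_trans (tensor_slotZ _ _ _ _ _ _).
  by apply: tensor_slot_null; exact: ncZ.
- move=> c t i x y xy; rewrite /formal_map /= !formal_map_upd.
  by apply: tensor_slot_null; exact: nc_null.
Qed.

Lemma formal_cost_map A u : (forall i, null_contraction (A i)) ->
  formal_cost N (formal_map A u) <= formal_cost N u.
Proof.
move=> hA; rewrite /formal_cost big_map; apply: ler_sum => ct _.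
rewrite ler_wpM2l ?normc_ge0//; apply: ler_prod => i _.
by rewrite N0 nc_le.
Qed.

Lemma proj_norm_map A u : (forall i, null_contraction (A i)) ->
  proj_norm N (formal_map A u) <= proj_norm N u.
Proof.
move=> hA; apply: lb_le_inf; first by case: (proj_norm_has_inf u).
move=> _ [v uv <-]; apply: le_trans (formal_cost_map v hA).
by apply: proj_norm_le; exact: tensor_eq_map.
Qed.

Lemma tensor_eq_mid x u v : tensor_eq N (u ++ x :: v) (x :: (u ++ v)).
Proof.
rewrite -(cat1s x v) -(cat1s x (u ++ v)) !catA; apply: tensor_cat; last exact: tensor_refl.
exact: tensor_catC.
Qed.

Lemma tensor_subxx u : tensor_eq N (formal_sub u u) [::].
Proof.
elim: u => [|[c t] u IH]; first exact: tensor_refl.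
rewrite /formal_sub /= mulN1r -/(formal_scale _ _).
apply: (@tensor_trans _ _ _ _ _ ([:: (c, t); (- c, t)] ++ formal_sub u u)).
  apply: (@tensor_cat _ _ _ _ [:: (c, t)] [:: (c, t)]); first exact: tensor_refl.
  exact: tensor_eq_mid.
apply: (@tensor_trans _ _ _ _ _ ([::] ++ [::])); last exact: tensor_refl.
apply: tensor_cat => //.
apply: tensor_trans (tensor_sym (tensor_coefD _ _ _ _)) _.
by rewrite subrr; exact: tensor_coef0.
Qed.

Lemma proj_norm_subxx u : proj_norm N (formal_sub u u) = 0.
Proof.
apply/le_anti; rewrite proj_norm_ge0 andbT.
apply: le_trans (proj_norm_le (tensor_subxx u)) _.
by rewrite /formal_cost big_nil.
Qed.

Lemma tensor_addK u v : tensor_eq N (v ++ formal_sub u v) u.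
Proof.
apply: (@tensor_trans _ _ _ _ _ ((u ++ formal_scale (- 1) v) ++ v)).
  exact: tensor_catC.
rewrite -catA -[X in tensor_eq _ _ X]cats0; apply: tensor_cat; first exact: tensor_refl.
by apply: tensor_trans (tensor_catC _ _ _) _; exact: tensor_subxx.
Qed.

(** The default in [tensor_map] is not taken: [formal_map A] does not increase the projective norm,
    so it carries the Cauchy sequence of f to a Cauchy sequence, which is itself an admissible g. *)
Lemma tensor_map_spec A (f : proj_tensor N d) : (forall i, null_contraction (A i)) ->
  proj_norm N (formal_sub (formal_map A (f n)) (tensor_map A f n)) @[n --> \oo] --> (0 : R).
Proof.
move=> hA; rewrite /tensor_map; case: xgetP => [g _ //|] /= nex; exfalso.
have cg : forall e : R, 0 < e -> exists n0, forall m n, (n0 <= m)%N -> (n0 <= n)%N ->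
    proj_norm N (formal_sub (formal_map A (f m)) (formal_map A (f n))) < e.
  move=> e e0; have [n0 hn0] := proj_cauchy f e0; exists n0 => m n mn0 nn0.
  rewrite -formal_map_sub; apply: le_lt_trans (hn0 m n mn0 nn0).
  exact: proj_norm_map.
apply: (nex (ProjTensor cg)) => /=.
under eq_fun do rewrite proj_norm_subxx; exact: cvg_cst.
Qed.

Fixpoint partial_tensor (v : nat -> tensor) n : tensor :=
  if n is m.+1 then partial_tensor v m ++ v m else [::].

Lemma formal_map_partial A (vs : nat -> tensor) n :
  formal_map A (partial_tensor vs n) = partial_tensor (fun j => formal_map A (vs j)) n.
Proof. by elim: n => //= n IH; rewrite formal_map_cat IH. Qed.

(** Telescoping along a fast subsequence: [v 0] is [f (s 0)], and [v n.+1] represents the difference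
    of two consecutive selected terms with cost below 2^-(n+1). The cost of [v 0] is not
    controlled. *)
Lemma proj_tensor_series (f : proj_tensor N d) :
  exists (v : nat -> tensor) (s : nat -> nat),
    [/\ forall n, (n <= s n)%N,
        forall n, tensor_eq N (f (s n)) (partial_tensor v n.+1) &
        forall n, formal_cost N (v n.+1) <= (2 ^- n.+1 : R)].
Proof.
have e0 n : 0 < (2 ^- n.+1 : R) by rewrite invr_gt0 exprn_gt0.
have /(_ _)/cid h n := proj_cauchy f (e0 n).
pose n0 n := sval (h n); have hn0 n := svalP (h n).
(* Summing the thresholds puts both [s n] and [s n.+1] past [n0 n]; the extra n gives [n <= s n]. *)
pose s n := (\sum_(i < n.+1) n0 i + n)%N.
have sle n : (n0 n <= s n)%N.
  by rewrite /s big_ord_recr /= -addnA addnCA leq_addr.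
have sS n : (n0 n <= s n.+1)%N.
  by rewrite /s big_ord_recr /= big_ord_recr /= -!addnA addnCA leq_addr.
have hv n : exists2 v, tensor_eq N (formal_sub (f (s n.+1)) (f (s n))) v &
    formal_cost N v < 2 ^- n.+1.
  by apply: proj_norm_lt; apply: hn0; [exact: sS|exact: sle].
pose v n := if n is m.+1 then sval (cid2 (hv m)) else f (s 0%N).
exists v, s; split.
- by move=> n; rewrite leq_addl.
- elim=> [|n IH]; first exact: tensor_refl.
  rewrite [partial_tensor v n.+2]/=; apply: tensor_sym.
  apply: tensor_trans (tensor_addK _ (f (s n))).
  apply: tensor_cat; first exact: tensor_sym.
  by apply: tensor_sym; rewrite /v; case: cid2.
- by move=> n; rewrite /v; case: cid2 => w /= _ /ltW.
Qed.

End TensorPower.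

(** * Restriction to the diagonal *)

Section Majorant.
Context {R : realType} {disp : measure_display} {X : measurableType disp}.
Variables (mu : probability X R) (p r : R) (p1 : 1 <= p) (r1 : 1 <= r) (d : nat).
Hypotheses (hd : (1 <= d)%N) (hpr : p = d%:R * r).
Notation V := (cLp mu p1).
Notation N := (@cLp_norm R disp X mu p p1).
Notation tensor := (@formal_tensor R V d).
Implicit Types (u v : tensor).

Let p0 : 0 < p. Proof. exact: lt_le_trans p1. Qed.
Let r0 : 0 < r. Proof. exact: lt_le_trans r1. Qed.

Definition weight (ct : R[i] * ('I_d -> V)) : R :=
  normc ct.1 * \prod_i N (ct.2 i).

(* When N (ct.2 i) = 0 the quotient is 0, but then so is the weight of ct. *)
Definition majorant u x : R :=
  \sum_(ct <- u) weight ct * \sum_i (normc (ct.2 i x) / N (ct.2 i)) `^ p.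

Lemma weight_ge0 ct : 0 <= weight ct.
Proof. by rewrite mulr_ge0 ?normc_ge0// prodr_ge0// => i _; exact: cLp_norm_ge0. Qed.

Lemma ratio_ge0 (t : 'I_d -> V) i x : 0 <= normc (t i x) / N (t i).
Proof. by rewrite divr_ge0 ?normc_ge0 ?cLp_norm_ge0. Qed.

Lemma majorant_ge0 u x : 0 <= majorant u x.
Proof.
apply: sumr_ge0 => ct _; rewrite mulr_ge0 ?weight_ge0//.
by apply: sumr_ge0 => i _; exact: powR_ge0.
Qed.

Lemma majorant_cat u v x : majorant (u ++ v) x = majorant u x + majorant v x.
Proof. exact: big_cat. Qed.

Lemma majorant_partial (vs : nat -> tensor) m x :
  majorant (partial_tensor vs m) x = \sum_(i < m) majorant (vs i) x.
Proof.
elim: m => [|m IH]; first by rewrite big_ord0 /majorant big_nil.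
by rewrite big_ord_recr /= majorant_cat IH.
Qed.

Lemma formal_cost_partial (vs : nat -> tensor) m :
  formal_cost N (partial_tensor vs m) = \sum_(i < m) formal_cost N (vs i).
Proof.
elim: m => [|m IH]; first by rewrite big_ord0 /formal_cost big_nil.
by rewrite big_ord_recr /= formal_cost_cat IH.
Qed.

Lemma measurable_ratio (t : V) :
  measurable_fun setT (fun x => (normc (t x) / N t) `^ p).
Proof.
apply: (@measurableT_comp _ _ _ _ _ _ (@powR R ^~ p)) => //.
by apply: measurable_funM => //; exact: measurable_normc (cLp_cmeasurable t).
Qed.

Lemma measurable_majorant u : measurable_fun setT (majorant u).
Proof.
apply: measurable_sum => ct; apply: measurable_funM => //.
by apply: measurable_sum => i; exact: measurable_ratio.
Qed.

Lemma integral_ratio (t : V) : (\int[mu]_x ((normc (t x) / N t) `^ p)%:E <= 1)%E.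
Proof.
have N0 := cLp_norm_ge0 t.
have E : (\int[mu]_x ((normc (t x) / N t) `^ p)%:E =
    (((N t)^-1) `^ p)%:E * ((N t) `^ p)%:E)%E.
  rewrite -pint_cLp /pint -ge0_integralZl_EFin ?powR_ge0//; last 2 first.
  - by move=> x _; rewrite lee_fin powR_ge0.
  - by apply/measurable_EFinP; exact: measurable_normc_powR (cLp_cmeasurable t).
  apply: eq_integral => x _; rewrite -EFinM powRM ?normc_ge0 ?invr_ge0//.
  by rewrite mulrC.
rewrite E -EFinM -powRM ?invr_ge0// lee_fin.
have [->|Nt] := eqVneq (N t) 0; first by rewrite mulr0 powR0// gt_eqF.
by rewrite mulVf// powR1.
Qed.

Lemma integral_majorant u : (\int[mu]_x (majorant u x)%:E <= (d%:R * formal_cost N u)%:E)%E.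
Proof.
under eq_integral do rewrite /majorant -sumEFin.
have mt (ct : R[i] * ('I_d -> V)) :
    measurable_fun setT (fun x => \sum_i (normc (ct.2 i x) / N (ct.2 i)) `^ p).
  by apply: measurable_sum => i; exact: measurable_ratio.
rewrite ge0_integral_sum//; last 2 first.
- by move=> ct; apply/measurable_EFinP; exact: measurable_funM.
- move=> ct x _; rewrite lee_fin mulr_ge0 ?weight_ge0//.
  by apply: sumr_ge0 => i _; exact: powR_ge0.
rewrite /formal_cost mulr_sumr -sumEFin; apply: lee_sum => ct _.
under eq_integral do rewrite EFinM.
rewrite ge0_integralZl_EFin ?weight_ge0//; last 2 first.
- by move=> x _; rewrite lee_fin; apply: sumr_ge0 => i _; exact: powR_ge0.
- exact/measurable_EFinP.
rewrite -/(weight ct) mulrC [X in (_ <= X)%E]EFinM; apply: lee_wpmul2l; first by rewrite lee_fin weight_ge0.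
under eq_integral do rewrite -sumEFin.
rewrite ge0_integral_sum//; last 2 first.
- by move=> i; apply/measurable_EFinP; exact: measurable_ratio.
- by move=> i x _; rewrite lee_fin powR_ge0.
rewrite (_ : d%:R%:E = \sum_(i < d) 1%:E)%E; last by rewrite sume_const// mule1.
by apply: lee_sum => i _; exact: integral_ratio.
Qed.

(** Factors of nonzero norm cancel that norm exactly. A factor of norm 0 has been replaced by the
    quotient 0, which bounds it only where the function vanishes; hence the null set. *)
Lemma normc_diag_le u : {ae mu, forall x, normc (formal_diag u x) <=
  \sum_(ct <- u) weight ct * \prod_i (normc (ct.2 i x) / N (ct.2 i))}.
Proof.
elim: u => [|[c t] u IH].
  by apply: aeW => x; rewrite /formal_diag !big_nil normc0.
have ht : {ae mu, forall x, forall i, N (t i) = 0 -> t i x = 0}.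
  apply: filter_forall => i.
  have [Ni|Ni] := eqVneq (N (t i)) 0; last by apply: aeW => x /eqP; rewrite (negbTE Ni).
  by move/cLp_norm0P : Ni; apply: filterS => x ->.
apply: filterS2 IH ht => x IH ht.
rewrite /formal_diag !big_cons; apply: le_trans (le_normcD _ _) _.
rewrite lerD//= normcM normc_prod /weight /= -mulrA ler_wpM2l ?normc_ge0//.
rewrite -big_split /=; apply: ler_prod => i _; rewrite normc_ge0/=.
have [Ni|Ni] := eqVneq (N (t i)) 0; first by rewrite ht// normc0 mul0r mulr0.
by rewrite mulrCA divff// mulr1.
Qed.

(** Jensen's inequality over the elementary tensors, then the product bound inside each. The
    right-hand side is additive in u, which suits series and averages alike. Tails are used with W =
    1, the first term of a series with a larger W. *)
Lemma diag_powR_le u (W : R) : 1 <= W -> formal_cost N u <= W ->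
  {ae mu, forall x, normc (formal_diag u x) `^ r <= W `^ r * majorant u x}.
Proof.
move=> W1 uW; apply: filterS (normc_diag_le u) => x hx.
have pr0 (ct : R[i] * ('I_d -> V)) : 0 <= \prod_i (normc (ct.2 i x) / N (ct.2 i)).
  by apply: prodr_ge0 => i _; exact: ratio_ge0.
apply: (@le_trans _ _ ((\sum_(ct <- u) weight ct *
    \prod_i (normc (ct.2 i x) / N (ct.2 i))) `^ r)).
  rewrite ge0_ler_powR ?(ltW r0) ?nnegrE ?normc_ge0//.
  by apply: sumr_ge0 => ct _; rewrite mulr_ge0 ?weight_ge0.
apply: le_trans (jensen_powR_scaled r1 weight_ge0 pr0 W1 uW) _.
rewrite ler_wpM2l ?powR_ge0//; apply: ler_sum => ct _.
rewrite ler_wpM2l ?weight_ge0//.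
by have := prodr_powR_le r1 hd (fun i => ratio_ge0 ct.2 i x); rewrite -hpr.
Qed.

Lemma pint_diag u (W : R) : 1 <= W -> formal_cost N u <= W ->
  (pint mu r (formal_diag u) <= (W `^ r * (d%:R * formal_cost N u))%:E)%E.
Proof.
move=> W1 uW.
apply: (@le_trans _ _ (\int[mu]_x (W `^ r * majorant u x)%:E)%E).
  apply: ae_ge0_le_integral => //.
  - by move=> x _; rewrite lee_fin powR_ge0.
  - by apply/measurable_EFinP; exact: measurable_normc_powR (cmeasurable_diag u).
  - by move=> x _; rewrite lee_fin mulr_ge0 ?powR_ge0 ?majorant_ge0.
  - by apply/measurable_EFinP; apply: measurable_funM => //; exact: measurable_majorant.
  by apply: filterS (diag_powR_le W1 uW) => x hx _; rewrite lee_fin.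
under eq_integral do rewrite EFinM.
rewrite ge0_integralZl_EFin ?powR_ge0//; last 2 first.
- by move=> x _; rewrite lee_fin majorant_ge0.
- by apply/measurable_EFinP; exact: measurable_majorant.
rewrite EFinM; apply: lee_wpmul2l; first by rewrite lee_fin powR_ge0.
exact: integral_majorant.
Qed.

(** Continuity of the restriction to the diagonal. The bound is linear in e and weaker than the e^r
    of a contraction, but it comes directly from the majorant of a representative of cost below
    e. *)
Lemma pint_diag_proj u (e : R) : proj_norm N u < e -> e <= 1 ->
  (pint mu r (formal_diag u) <= (d%:R * e)%:E)%E.
Proof.
move=> ue e1; have [v uv ve] := proj_norm_lt (@cLp_norm_ge0 _ _ _ mu p p1) ue.
apply: (@le_trans _ _ (pint mu r (formal_diag v))).
  apply: pint_ae_le; [exact: ltW|exact: cmeasurable_diag|exact: cmeasurable_diag|].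
  by apply: filterS (formal_diag_eq uv) => x ->.
apply: le_trans (pint_diag (lexx 1) (le_trans (ltW ve) e1)) _.
by rewrite powR1 mul1r lee_fin ler_wpM2l// ltW.
Qed.

End Majorant.

(** * Summable series of tensors and their diagonal limits *)

Section Series.
Context {R : realType} {disp : measure_display} {X : measurableType disp}.
Variables (mu : probability X R) (p r : R) (p1 : 1 <= p) (r1 : 1 <= r) (d : nat).
Hypotheses (hd : (1 <= d)%N) (hpr : p = d%:R * r).
Notation V := (cLp mu p1).
Notation N := (@cLp_norm R disp X mu p p1).
Notation tensor := (@formal_tensor R V d).
Implicit Types (u v : tensor) (vs : nat -> tensor).

Let r0 : 0 < r. Proof. exact: lt_le_trans r1. Qed.

(** The term of index 0 is left unconstrained: it is a first approximation of f, and only the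
    corrections are small. *)
Definition summable_tensors vs := forall n, formal_cost N (vs n.+1) <= 2 ^- n.+1.

(** It starts at index J + 1 because it controls the distance to [partial_tensor vs J.+1], whose
    last term is [vs J]. Values are extended since the series is finite only almost everywhere. *)
Definition tail_majorant vs J x : \bar R :=
  (\sum_(i <oo) (majorant (vs (i + J).+1) x)%:E)%E.

Lemma tail_majorant_ge0 vs J x : (0 <= tail_majorant vs J x)%E.
Proof. by apply: nneseries_ge0 => i _ _; rewrite lee_fin majorant_ge0. Qed.

Lemma measurable_tail_majorant vs J : measurable_fun setT (tail_majorant vs J).
Proof.
apply: ge0_emeasurable_sum => i *; first by rewrite lee_fin majorant_ge0.
by apply/measurable_EFinP; exact: measurable_majorant.
Qed.

Lemma geometric_tail (J m : nat) : \sum_(i < m) (2 ^- (i + J).+1 : R) <= 2 ^- J.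
Proof.
suff -> : \sum_(i < m) (2 ^- (i + J).+1 : R) = 2 ^- J - 2 ^- (m + J).
  by rewrite gerBl invr_ge0 exprn_ge0.
elim: m => [|m IH]; first by rewrite big_ord0 subrr.
rewrite big_ord_recr /= IH addSn [2 ^+ (m + J).+1]exprS invfM.
lra.
Qed.

Lemma integral_tail_majorant vs J : summable_tensors vs ->
  (\int[mu]_x tail_majorant vs J x <= (d%:R * 2 ^- J)%:E)%E.
Proof.
move=> hvs.
rewrite /tail_majorant integral_nneseries//; last 2 first.
- by move=> i; apply/measurable_EFinP; exact: measurable_majorant.
- by move=> i x _; rewrite lee_fin majorant_ge0.
apply: lime_le.
  by apply: is_cvg_nneseries => i *; apply: integral_ge0 => x _; rewrite lee_fin majorant_ge0.
apply: nearW => m; rewrite big_mkord.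
apply: (@le_trans _ _ (\sum_(i < m) (d%:R * 2 ^- (i + J).+1)%:E)%E).
  apply: lee_sum => i _; apply: le_trans (integral_majorant _) _.
  by rewrite lee_fin ler_wpM2l.
by rewrite sumEFin lee_fin -mulr_sumr ler_wpM2l// geometric_tail.
Qed.

Lemma partial_tensorD vs J m :
  partial_tensor vs (m + J).+1 =
  partial_tensor vs J.+1 ++ partial_tensor (fun i => vs (i + J).+1) m.
Proof.
elim: m => [|m IH]; first by rewrite /= cats0.
by rewrite addSn -[LHS]/(partial_tensor vs (m + J).+1 ++ _) IH -catA.
Qed.

Lemma summable_tensorsW vs J m : summable_tensors vs ->
  formal_cost N (partial_tensor (fun i => vs (i + J).+1) m) <= 2 ^- J.
Proof.
move=> hvs; rewrite formal_cost_partial; apply: le_trans (geometric_tail J m).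
by apply: ler_sum => i _; exact: hvs.
Qed.

(** The tensor between the two partial sums costs at most 2^-J <= 1, so W = 1 is allowed and no
    constant appears. *)
Lemma ae_diag_increment vs : summable_tensors vs ->
  {ae mu, forall x, forall J m,
    ((normc (formal_diag (partial_tensor vs (m + J).+1) x -
      formal_diag (partial_tensor vs J.+1) x) `^ r)%:E <= tail_majorant vs J x)%E}.
Proof.
move=> hvs; apply: ae_foralln => J; apply: ae_foralln => m.
have c1 : formal_cost N (partial_tensor (fun i => vs (i + J).+1) m) <= 1.
  apply: le_trans (summable_tensorsW _ _ hvs) _.
  by rewrite invf_le1 ?exprn_gt0// exprn_ege1// ler1n.
apply: filterS (diag_powR_le r1 hd hpr (lexx 1) c1) => x.
rewrite powR1 mul1r partial_tensorD formal_diag_cat [X in normc (X - _)]addrC addrK => h.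
apply: (@le_trans _ _ (majorant (partial_tensor (fun i => vs (i + J).+1) m) x)%:E).
  by rewrite lee_fin.
rewrite majorant_partial -sumEFin -(big_mkord xpredT (fun i => (majorant (vs (i + J).+1) x)%:E)).
by apply: nneseries_lim_ge => i *; rewrite lee_fin majorant_ge0.
Qed.

Lemma ae_tail_majorant_lty vs : summable_tensors vs ->
  {ae mu, forall x, (tail_majorant vs 0 x < +oo)%E}.
Proof.
move=> hvs.
have iH : mu.-integrable setT (tail_majorant vs 0).
  apply/integrableP; split; first exact: measurable_tail_majorant.
  under eq_integral do rewrite gee0_abs ?tail_majorant_ge0//.
  by apply: le_lt_trans (integral_tail_majorant 0 hvs) _; rewrite ltry.
apply: filterS (integrable_ae measurableT iH) => x /(_ I).
by rewrite ge0_fin_numE// tail_majorant_ge0.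
Qed.

Lemma tail_majorant_le vs J x : (tail_majorant vs J x <= tail_majorant vs 0 x)%E.
Proof.
pose f i := (majorant (vs i.+1) x)%:E.
have f0 i : (0 <= f i)%E by rewrite lee_fin majorant_ge0.
rewrite /tail_majorant (nneseries_addn J f0) (nneseries_addn 0 f0).
rewrite [leRHS](nneseries_split 0 J)// add0n.
by rewrite leeDr//; apply: sume_ge0.
Qed.

Lemma tail_majorant_cvg0 vs x : (tail_majorant vs 0 x < +oo)%E ->
  tail_majorant vs J x @[J --> \oo] --> 0%E.
Proof.
pose f i := (majorant (vs i.+1) x)%:E.
have f0 i : (0 <= f i)%E by rewrite lee_fin majorant_ge0.
rewrite /tail_majorant (nneseries_addn 0 f0) => h.
under eq_fun do rewrite (nneseries_addn _ f0).
exact: nneseries_tail_cvg.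
Qed.

Lemma powR_le_cancel (a b : R) : 0 <= a -> 0 <= b -> a `^ r <= b `^ r -> a <= b.
Proof.
move=> a0 b0 h; rewrite leNgt; apply/negP => ba.
by move: h; rewrite leNgt gt0_ltr_powR ?nnegrE.
Qed.

Lemma cauchy_of_tail (z : nat -> R[i]) (H : nat -> \bar R) :
  H J @[J --> \oo] --> 0%E ->
  (forall J, (0 <= H J)%E) ->
  (forall J m, ((normc (z (m + J).+1 - z J.+1) `^ r)%:E <= H J)%E) ->
  cvg (complex.Re (z n) @[n --> \oo]) /\ cvg (complex.Im (z n) @[n --> \oo]).
Proof.
move=> H0 Hge0 zH.
have key (e : R) : 0 < e -> exists J, forall n, (J.+1 <= n)%N -> normc (z n - z J.+1) < e.
  move=> e0; have e2 : 0 < e / 2 by rewrite divr_gt0.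
  have /(cvge0_leP _ Hge0) /(_ ((e / 2) `^ r)) := H0.
  rewrite powR_gt0// => /(_ isT)[J _ /(_ J (leqnn J))/= HJ].
  exists J => n Jn; rewrite -(subnK Jn) addnS.
  apply: (@le_lt_trans _ _ (e / 2)); last by lra.
  apply: powR_le_cancel; [exact: normc_ge0|exact: ltW|].
  by rewrite -lee_fin; apply: le_trans (zH J _) HJ.
split; apply/cauchy_cvgP; apply: cauchy_exP => e e0; have [J hJ] := key e e0.
  exists (complex.Re (z J.+1)); exists J.+1 => // n /= Jn.
  rewrite -ball_normE /ball_ /= distrC -ReB.
  by apply: le_lt_trans (Re_le_normc _) (hJ n Jn).
exists (complex.Im (z J.+1)); exists J.+1 => // n /= Jn.
rewrite -ball_normE /ball_ /= distrC -ImB.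
by apply: le_lt_trans (Im_le_normc _) (hJ n Jn).
Qed.

(** Pointwise completeness replaces completeness of L_r: off one null set B the tail tends to 0,
    which makes the partial sums Cauchy. The limit thus comes with a pointwise error bound. *)
Lemma series_limit vs : summable_tensors vs ->
  exists g : cLp mu r1,
    {ae mu, forall x,
      formal_diag (partial_tensor vs n) x @[n --> \oo] --> (g x : R[i]^o)} /\
    {ae mu, forall x, forall J,
      ((normc (formal_diag (partial_tensor vs J.+1) x - g x) `^ r)%:E
        <= tail_majorant vs J x)%E}.
Proof.
move=> hvs; pose z n x := formal_diag (partial_tensor vs n) x.
have [B [mB B0 hB]] := filterI (ae_diag_increment hvs) (ae_tail_majorant_lty hvs).
have {}hB x : ~ B x -> (forall J m,
    ((normc (z (m + J).+1 x - z J.+1 x) `^ r)%:E <= tail_majorant vs J x)%E) /\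
    (tail_majorant vs 0 x < +oo)%E.
  by move=> nB; apply: contrapT => h; apply: nB; exact: hB.
have aeB : {ae mu, forall x, ~ B x}.
  by exists B; split => // x /= /contrapT.
have cz x : ~ B x -> cvg (complex.Re (z n x) @[n --> \oo]) /\ cvg (complex.Im (z n x) @[n --> \oo]).
  move=> /hB[h1 h2]; apply: (cauchy_of_tail (tail_majorant_cvg0 h2)) => //.
  by move=> J; exact: tail_majorant_ge0.
(* With the value 0 on B, this is an everywhere limit of partial sums multiplied by the indicator of
   the complement of B, hence measurable. *)
pose gr x := if x \in B then 0 else lim (complex.Re (z n x) @[n --> \oo]).
pose gi x := if x \in B then 0 else lim (complex.Im (z n x) @[n --> \oo]).
have mlim (f : nat -> X -> R) : (forall n, measurable_fun setT (f n)) ->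
    (forall x, ~ B x -> cvg (f n x @[n --> \oo])) ->
    measurable_fun setT (fun x => if x \in B then 0 else lim (f n x @[n --> \oo])).
  move=> mf cf; apply: (@measurable_fun_cvg _ _ _ _ (fun n x => f n x * \1_(~` B) x)).
    move=> n; apply: measurable_funM => //.
    by apply: measurable_indic; exact: measurableC.
  move=> x _; rewrite indicE in_setC; have [xB|xB] := boolP (x \in B).
    by under eq_fun do rewrite mulr0; exact: cvg_cst.
  under eq_fun do rewrite mulr1.
  by apply: cf => /mem_set; rewrite (negbTE xB).
have mg : cmeasurable (fun x => gr x +i* gi x).
  split; [apply: (mlim (fun n x => complex.Re (z n x)))|
          apply: (mlim (fun n x => complex.Im (z n x)))].
  - by move=> n; case: (cmeasurable_diag (partial_tensor vs n)).
  - by move=> x /cz[].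
  - by move=> n; case: (cmeasurable_diag (partial_tensor vs n)).
  - by move=> x /cz[].
have cg x : ~ B x -> z n x @[n --> \oo] --> ((gr x +i* gi x) : R[i]^o).
  move=> nB; have [c1 c2] := cz x nB.
  by apply: cvg_complex_ReIm => /=; rewrite /gr /gi memNset.
have bg x : ~ B x -> forall J,
    ((normc (z J.+1 x - (gr x +i* gi x)) `^ r)%:E <= tail_majorant vs J x)%E.
  move=> nB J; have [h1 h2] := hB x nB.
  have Hf : tail_majorant vs J x \is a fin_num.
    by rewrite ge0_fin_numE ?tail_majorant_ge0// (le_lt_trans (tail_majorant_le _ _ _)).
  rewrite -(fineK Hf) lee_fin.
  have /cvg_normcP c := cg x nB.
  set h := fine _; have h0 : 0 <= h by rewrite fine_ge0// tail_majorant_ge0.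
  (* The passage to the limit is made on r-th roots, where the triangle inequality holds without a
     constant. *)
  rewrite -[h]powRr1// -(@mulVf _ r) ?gt_eqF// powRrM.
  rewrite ge0_ler_powR ?(ltW r0) ?nnegrE ?normc_ge0 ?powR_ge0//.
  apply/ler_addgt0Pr => e e0.
  move/cvgrPdist_le : c => /(_ e e0)[M _ /(_ (M + J).+1)].
  rewrite /= ltnW ?ltnS ?leq_addr// => /(_ isT).
  rewrite sub0r normrN ger0_norm ?normc_ge0// => hM.
  rewrite -[z J.+1 x](subrK (z (M + J).+1 x)) -addrA.
  apply: le_trans (le_normcD _ _) _; apply: lerD hM; rewrite normcB.
  apply: powR_le_cancel; rewrite ?normc_ge0 ?powR_ge0//.
  rewrite -powRrM mulVf ?gt_eqF// powRr1//.
  by rewrite -lee_fin fineK.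
have gL : (fun x => gr x +i* gi x) \in cLfun mu r.
  apply/cLfunP => //; split=> //.
  have mz := cmeasurable_diag (partial_tensor vs 1).
  (* The limit is its difference with the first partial sum, bounded by the tail, plus that sum,
     whose cost may exceed 1 and is absorbed in W. *)
  have := pint_triangle mu r1 (cmeasurableB mg mz) mz.
  rewrite (_ : (fun x => _ - _ + _) = fun x => gr x +i* gi x); last first.
    by apply/funext => x; rewrite subrK.
  move=> /le_lt_trans; apply.
  apply: lte_mul_pinfty; rewrite ?lee_fin ?powR_ge0//.
  apply: lte_add_pinfty; last first.
    have W1 : 1 <= Num.max 1 (formal_cost N (partial_tensor vs 1)) by rewrite le_max lexx.
    apply: le_lt_trans (pint_diag r1 hd hpr W1 _) (ltry _).
    by rewrite le_max lexx orbT.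
  apply: le_lt_trans (le_lt_trans (integral_tail_majorant 0 hvs) (ltry _)).
  apply: ae_ge0_le_integral => //.
  - by move=> x _; rewrite lee_fin powR_ge0.
  - by apply/measurable_EFinP; apply: measurable_normc_powR; exact: cmeasurableB.
  - by move=> x _; exact: tail_majorant_ge0.
  - exact: measurable_tail_majorant.
  by apply: filterS aeB => x /bg/(_ 0%N) + _; rewrite normcB.
exists (CLp r1 gL); split.
- by apply: filterS aeB => x; exact: cg.
- by apply: filterS aeB => x; exact: bg.
Qed.

Lemma pint_series_limit vs (g : cLp mu r1) J : summable_tensors vs ->
  {ae mu, forall x, forall J,
      ((normc (formal_diag (partial_tensor vs J.+1) x - g x) `^ r)%:E
        <= tail_majorant vs J x)%E} ->
  (pint mu r (fun x => (formal_diag (partial_tensor vs J.+1) x - g x)%R) <= (d%:R * 2 ^- J)%:E)%E.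
Proof.
move=> hvs H; apply: le_trans (integral_tail_majorant J hvs).
apply: ae_ge0_le_integral => //.
- by move=> x _; rewrite lee_fin powR_ge0.
- apply/measurable_EFinP; apply: measurable_normc_powR; apply: cmeasurableB.
    exact: cmeasurable_diag.
  exact: cLp_cmeasurable.
- by move=> x _; exact: tail_majorant_ge0.
- exact: measurable_tail_majorant.
by apply: filterS H => x /(_ J).
Qed.

Lemma pint_sym (f g : X -> R[i]) :
  pint mu r (fun x => f x - g x) = pint mu r (fun x => g x - f x).
Proof. by apply: eq_integral => x _; rewrite normcB. Qed.

Lemma pint_triangle3 (f g h : X -> R[i]) :
  cmeasurable f -> cmeasurable g -> cmeasurable h ->
  (pint mu r (fun x => (f x - h x)%R) <= (2 `^ r)%:E *
    (pint mu r (fun x => (f x - g x)%R) + pint mu r (fun x => (g x - h x)%R)))%E.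
Proof.
move=> mf mg mh.
have := pint_triangle mu r1 (cmeasurableB mf mg) (cmeasurableB mg mh).
by under [X in (pint mu r X <= _)%E -> _]eq_fun do rewrite subrKA.
Qed.

(** The existence of g excludes the default in [D_op], and two limits in L_r of one sequence agree
    almost everywhere. *)
Lemma D_op_unique (F : Lppi mu p1 d) (g : cLp mu r1) :
  pint mu r (fun x => formal_diag (F n) x - g x) @[n --> \oo] --> 0%E ->
  {ae mu, forall x, D_op r1 F x = g x}.
Proof.
move=> Hg; rewrite /D_op; case: xgetP => [g' _ /=|/= nex]; last first.
  by exfalso; apply: (nex g) => /=; apply/cLnorm_cvg0P.
move=> /(cLnorm_cvg0P mu _ _ r1) Hg'.
have mF n := cmeasurable_diag (F n).
have mg := cLp_cmeasurable g; have mg' := cLp_cmeasurable g'.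
have C0 : 0 < 2 `^ r by exact: powR_gt0.
suff : pint mu r (fun x => g' x - g x) = 0%E.
  move=> /(cint_powR0_ae r1 (cmeasurableB mg' mg)); apply: filterS => x /eqP.
  by rewrite subr_eq0 => /eqP.
apply/le_anti; rewrite pint_ge0 andbT; apply/lee_addgt0Pr => e e0.
rewrite add0e.
have e'0 : 0 < e / 2 / 2 `^ r by rewrite !divr_gt0.
move/(cvge0_leP _ (fun n => pint_ge0 _ _ _)) : Hg => /(_ _ e'0) Hg.
move/(cvge0_leP _ (fun n => pint_ge0 _ _ _)) : Hg' => /(_ _ e'0) Hg'.
have [n [h1 h2]] := filter_ex (filterI Hg Hg').
apply: le_trans (pint_triangle3 mg' (mF n) mg) _.
rewrite pint_sym.
apply: (@le_trans _ _ ((2 `^ r)%:E * ((e / 2 / 2 `^ r)%:E + (e / 2 / 2 `^ r)%:E))%E).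
  by apply: lee_wpmul2l; rewrite ?lee_fin ?(ltW C0)//; exact: leeD.
by rewrite -EFinD -EFinM lee_fin -mulrDl -splitr mulrC divfK ?gt_eqF.
Qed.

(** [D_op] is defined by an L_r limit along the sequence stored in F, which [tensor_map] chooses
    arbitrarily. Any series equivalent to F computes it as well, and brings the pointwise
    information that an L_r limit does not give. *)
Lemma D_op_series (F : Lppi mu p1 d) (w : nat -> tensor) vs (s : nat -> nat) :
  summable_tensors vs -> (forall n, (n <= s n)%N) ->
  (forall n, tensor_eq N (w (s n)) (partial_tensor vs n.+1)) ->
  (proj_norm N (formal_sub (w n) (F n)) @[n --> \oo] --> (0 : R)) ->
  {ae mu, forall x,
      formal_diag (partial_tensor vs n) x @[n --> \oo] --> (D_op r1 F x : R[i]^o)} /\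
  {ae mu, forall x, forall J,
      ((normc (formal_diag (partial_tensor vs J.+1) x - D_op r1 F x) `^ r)%:E
        <= tail_majorant vs J x)%E}.
Proof.
move=> hvs hs hw wF.
have [g [cg bg]] := series_limit hvs.
suff Dg : {ae mu, forall x, D_op r1 F x = g x}.
  by split; [apply: filterS2 Dg cg => x ->|apply: filterS2 Dg bg => x ->].
apply: D_op_unique; apply/cvge0_leP => [n|e e0]; first exact: pint_ge0.
have mF n := cmeasurable_diag (F n).
have mw n := cmeasurable_diag (w n).
have mv n := cmeasurable_diag (partial_tensor vs n).
have mg := cLp_cmeasurable g.
pose C : R := 2 `^ r; have C0 : 0 < C by exact: powR_gt0.
pose D : R := d%:R; have D0 : 0 < D by rewrite ltr0n.
(* Two nested uses of [pint_triangle3] with three errors of size D e1 add up to K e1; the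
   requirement e1 <= 1 below comes from [pint_diag_proj]. *)
pose K := C * D + C * (C * D + C * D).
have K0 : 0 < K by rewrite !(addr_gt0, mulr_gt0).
pose e1 := Num.min 1 (e / K).
have e10 : 0 < e1 by rewrite lt_min ltr01 divr_gt0.
have e11 : e1 <= 1 by rewrite ge_min lexx.
have e1K : K * e1 <= e by rewrite mulrC -ler_pdivlMr// ge_min lexx orbT.
have [n0 hn0] := proj_cauchy F e10.
have [n1 _ hn1] : \forall n \near \oo, proj_norm N (formal_sub (w n) (F n)) < e1.
  move/cvgrPdist_lt : wF => /(_ _ e10); apply: filterS => n.
  by rewrite sub0r normrN ger0_norm// proj_norm_ge0// => ?; exact: cLp_norm_ge0.
have [n2 _ hn2] : \forall n \near \oo, (2 ^- n : R) < e1.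
  have := @cvg_geometric R 1 2^-1; rewrite ger0_norm// => /(_ _).
  rewrite invf_lt1// ltr1n => /(_ isT)/cvgrPdist_lt/(_ _ e10); apply: filterS => n.
  by rewrite sub0r normrN /= mul1r exprVn ger0_norm// invr_ge0 exprn_ge0.
exists n0 => // n /= n0n.
pose J := (n0 + n1 + n2)%N.
have Js := hs J.
have dsub a b : pint mu r (formal_diag (formal_sub a b)) =
    pint mu r (fun x => formal_diag a x - formal_diag b x).
  by apply: eq_integral => x _; rewrite formal_diag_sub.
have A1 : (pint mu r (fun x => (formal_diag (F n) x - formal_diag (F (s J)) x)%R) <= (D * e1)%:E)%E.
  rewrite -dsub; apply: (pint_diag_proj r1 hd hpr _ e11).
  by apply: hn0 => //; apply: leq_trans Js; rewrite /J -addnA leq_addr.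
have A2 : (pint mu r (fun x => (formal_diag (F (s J)) x - formal_diag (w (s J)) x)%R) <= (D * e1)%:E)%E.
  rewrite pint_sym -dsub; apply: (pint_diag_proj r1 hd hpr _ e11).
  by apply: hn1 => /=; apply: leq_trans Js; rewrite /J addnAC leq_addl.
have A3 : (pint mu r (fun x => (formal_diag (w (s J)) x - g x)%R) <= (D * e1)%:E)%E.
  apply: (@le_trans _ _ (D * 2 ^- J)%:E); last first.
    by rewrite lee_fin ler_wpM2l ?(ltW D0)// ltW//; apply: hn2; rewrite /= /J leq_addl.
  apply: le_trans (pint_series_limit J hvs bg); apply: pint_ae_le.
  - exact: ltW.
  - exact: cmeasurableB.
  - exact: cmeasurableB.
  by apply: filterS (formal_diag_eq (hw J)) => x ->.
apply: le_trans (pint_triangle3 (mF n) (mF (s J)) mg) _.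
apply: (@le_trans _ _ (C%:E * ((D * e1)%:E + (C * (D * e1 + D * e1))%:E))%E).
  apply: lee_wpmul2l; first by rewrite lee_fin ltW.
  apply: (leeD A1).
  apply: le_trans (pint_triangle3 (mF (s J)) (mw (s J)) mg) _.
  by rewrite EFinM EFinD; apply: lee_wpmul2l; [rewrite lee_fin ltW|exact: leeD].
rewrite -EFinD -EFinM lee_fin; apply: le_trans e1K.
by rewrite /K le_eqVlt; apply/orP; left; apply/eqP; ring.
Qed.

End Series.

(** * Averages over boxes *)

Section Box.

(** Distributivity over a box whose sides are different types: the index set is identified with
    [fprod], and tagging the sides makes the uniform law [bigA_distr_big_dep] applicable. *)
Lemma sum_dffun_prod (K : comNzRingType) (I : finType) (T_ : I -> finType)
    (P : forall i, T_ i -> K) :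
  \sum_(k : {dffun forall i, T_ i}) \prod_i P i (k i) =
  \prod_i \sum_(j : T_ i) P i j.
Proof.
rewrite (reindex (@dffun_of_fprod _ T_)); last first.
  exact/onW_bij/dffun_of_fprod_bij.
under eq_bigr => k _ do under eq_bigr => i _ do rewrite ffunE.
pose Pf i : {ffun T_ i -> K} := [ffun j => P i j].
transitivity (\sum_(k : fprod T_) \prod_(i in I) Pf i (k i)).
  by apply: eq_bigr => k _; apply: eq_bigr => i _; rewrite ffunE.
rewrite big_fprod -(bigA_distr_big_dep (fun i => tagged_with T_ i)
  (fun i j => untag 0 (Pf i) j)).
apply: eq_bigr => i _; rewrite -(big_tag (fun i => Pf i)).
by apply: eq_bigr => j _; rewrite ffunE.
Qed.

Definition box_avg {K : fieldType} {d : nat} (n : 'I_d -> nat)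
    (z : {dffun forall i : 'I_d, 'I_(n i)} -> K) : K :=
  (\prod_(i < d) (n i)%:R)^-1 * \sum_k z k.

Lemma box_avg_prod (K : fieldType) (d : nat) (n : 'I_d -> nat)
    (P : 'I_d -> nat -> K) :
  box_avg (fun k : {dffun forall i : 'I_d, 'I_(n i)} => \prod_i P i (k i)) =
  \prod_i ((n i)%:R^-1 * \sum_(j < n i) P i j).
Proof.
rewrite /box_avg (sum_dffun_prod (fun i (j : 'I_(n i)) => P i j)).
by rewrite -prodfV -big_split.
Qed.

(** A function of the coordinate i0 is a product whose other factors are constantly 1; each of these
    averages to 1 because its side is nonempty. *)
Lemma box_avg_coord (K : numFieldType) (d : nat) (n : 'I_d -> nat) (i0 : 'I_d)
    (f : nat -> K) : (forall i, 0 < n i)%N ->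
  box_avg (fun k : {dffun forall i : 'I_d, 'I_(n i)} => f (k i0)) =
  (n i0)%:R^-1 * \sum_(j < n i0) f j.
Proof.
move=> n0; pose P i j := if i == i0 then f j else 1.
have -> : (fun k : {dffun forall i : 'I_d, 'I_(n i)} => f (k i0)) =
    (fun k => \prod_i P i (k i)).
  apply/funext => k; rewrite (bigD1 i0)//= /P eqxx big1 ?mulr1// => i.
  by move=> /negbTE ->.
rewrite box_avg_prod (bigD1 i0)//= [X in _ * X]big1 ?mulr1; last first.
  move=> i /negbTE ii0; rewrite /P ii0 sumr_const card_ord.
  by rewrite -[X in _ * X]mulr_natl mulr1 mulVf// pnatr_eq0 -lt0n.
by congr (_ * _); apply: eq_bigr => j _; rewrite /P eqxx.
Qed.

Lemma box_avg1 (K : numFieldType) (d : nat) (n : 'I_d -> nat) :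
  (forall i, 0 < n i)%N ->
  box_avg (fun k : {dffun forall i : 'I_d, 'I_(n i)} => 1) = 1 :> K.
Proof.
move=> n0; pose P (i : 'I_d) (j : nat) : K := 1.
have -> : (fun k : {dffun forall i : 'I_d, 'I_(n i)} => 1) =
    (fun k => \prod_i P i (k i)).
  by apply/funext => k; rewrite big1.
rewrite box_avg_prod big1// => i _.
rewrite sumr_const card_ord -[X in _ * X]mulr_natl mulr1 mulVf//.
by rewrite pnatr_eq0 -lt0n.
Qed.

Lemma box_avgD (K : fieldType) (d : nat) (n : 'I_d -> nat)
    (y z : {dffun forall i : 'I_d, 'I_(n i)} -> K) :
  box_avg (fun k => y k + z k) = box_avg y + box_avg z.
Proof. by rewrite /box_avg big_split mulrDr. Qed.

Lemma box_avgB (K : fieldType) (d : nat) (n : 'I_d -> nat)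
    (y z : {dffun forall i : 'I_d, 'I_(n i)} -> K) :
  box_avg (fun k => y k - z k) = box_avg y - box_avg z.
Proof. by rewrite /box_avg sumrB mulrBr. Qed.

Lemma box_avgZ (K : fieldType) (d : nat) (n : 'I_d -> nat) (c : K)
    (z : {dffun forall i : 'I_d, 'I_(n i)} -> K) :
  box_avg (fun k => c * z k) = c * box_avg z.
Proof. by rewrite /box_avg -mulr_sumr mulrCA. Qed.

Lemma box_avg_sum (K : fieldType) (d : nat) (n : 'I_d -> nat) (J : Type) (s : seq J)
    (z : J -> {dffun forall i : 'I_d, 'I_(n i)} -> K) :
  box_avg (fun k => \sum_(j <- s) z j k) = \sum_(j <- s) box_avg (z j).
Proof. by rewrite /box_avg exchange_big mulr_sumr. Qed.

Lemma ler_box_avg (K : numFieldType) (d : nat) (n : 'I_d -> nat)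
    (y z : {dffun forall i : 'I_d, 'I_(n i)} -> K) :
  (forall k, y k <= z k) -> box_avg y <= box_avg z.
Proof.
move=> yz; rewrite /box_avg ler_wpM2l ?invr_ge0 ?prodr_ge0//.
exact: ler_sum.
Qed.

Lemma normc_box_avg {R : realType} (r : R) (d : nat) (n : 'I_d -> nat)
    (z : {dffun forall i : 'I_d, 'I_(n i)} -> R[i]) : 1 <= r ->
  (forall i, 0 < n i)%N ->
  normc (box_avg z) `^ r <= box_avg (fun k => normc (z k) `^ r).
Proof.
move=> r1 n0; have r0 : 0 < r by exact: lt_le_trans r1.
pose c : R := (\prod_(i < d) (n i)%:R)^-1.
have c0 : 0 <= c by rewrite invr_ge0 prodr_ge0.
have cE : (\prod_(i < d) (n i)%:R)^-1 = c%:C.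
  rewrite /c fmorphV rmorph_prod; congr (_ ^-1).
  by apply: eq_bigr => i _; rewrite rmorph_nat.
rewrite /box_avg cE normcM normc_real ger0_norm//.
apply: (@le_trans _ _ ((\sum_k c * normc (z k)) `^ r)).
  rewrite ge0_ler_powR ?(ltW r0) ?nnegrE//.
  - by rewrite mulr_ge0// normc_ge0.
  - by apply: sumr_ge0 => k _; rewrite mulr_ge0// normc_ge0.
  by rewrite -mulr_sumr ler_wpM2l//; exact: normc_sum.
rewrite mulr_sumr; apply: jensen_powR => //.
  by move=> k; exact: normc_ge0.
have -> : \sum_(k : {dffun forall i : 'I_d, 'I_(n i)}) c =
    box_avg (fun _ : {dffun forall i : 'I_d, 'I_(n i)} => 1).
  by rewrite /box_avg mulr_sumr; apply: eq_bigr => k _; rewrite mulr1.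
by rewrite box_avg1.
Qed.

End Box.

Section MultiIndex.
Context {d : nat}.

Lemma cvg_multi_oo (U : Type) (F : set_system U) (u : nat -> U) (i : 'I_d) :
  (u n @[n --> \oo] `=>` F) -> u (n i) @[n --> multi_oo d] `=>` F.
Proof.
move=> h P /h [M _ hM]; exists M => // n /= Mn; exact: (hM _ (Mn i)).
Qed.

Lemma multi_oo_gt0 : \forall n \near multi_oo d, forall i, (0 < n i)%N.
Proof. by exists 1%N. Qed.

Lemma multi_oo_seq (ns : nat -> 'I_d -> nat) : (forall m i, (m <= ns m i)%N) ->
  ns m @[m --> \oo] `=>` multi_oo d.
Proof.
move=> h P [M _ hM]; exists M => // m /= Mm; apply: hM => i /=.
exact: leq_trans Mm (h m i).
Qed.

(** The filter has a countable base: choosing for each m a bad multi-index with all entries above m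
    gives a sequence along which P fails. *)
Lemma multi_oo_counterexample (P : set ('I_d -> nat)) :
  ~ (\forall n \near multi_oo d, P n) ->
  exists ns : nat -> 'I_d -> nat, (forall m i, (m < ns m i)%N) /\ forall m, ~ P (ns m).
Proof.
move=> nP; have h m : exists n : 'I_d -> nat, (forall i, (m < n i)%N) /\ ~ P n.
  apply: contrapT => h; apply: nP; exists m.+1 => // n /= mn.
  by apply: contrapT => nPn; apply: h; exists n.
have /(_ _)/cid {}h := h.
exists (fun m => sval (h m)); split=> m; first by case: (svalP (h m)).
by case: (svalP (h m)).
Qed.

End MultiIndex.

(** * The multiparameter ergodic theorem *)

Section Assemble.
Context {R : realType} {disp : measure_display} {X : measurableType disp}.
Variables (mu : probability X R) (T : X -> X) (hT : measure_preserving mu T).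

(** A conditional expectation of h need be nonnegative only almost everywhere; its absolute value is
    still the limit, since the averages are nonnegative. *)
Lemma birkhoff_nonneg (h : X -> R) : mu.-integrable setT (EFin \o h) ->
  (forall x, 0 <= h x) ->
  exists e : X -> R, [/\ measurable_fun setT e, (forall x, 0 <= e x),
    (\int[mu]_x (e x)%:E = \int[mu]_x (h x)%:E)%E &
    {ae mu, forall x, birkhoff_avg T h n x @[n --> \oo] --> e x}].
Proof.
move=> ih h0; have [g [Gg ig Eg]] := @invariant_cond_exp_exists _ _ _ mu T _ ih.
have mg : measurable_fun setT g by apply/measurable_EFinP; exact: measurable_int ig.
have hg : {ae mu, forall x, birkhoff_avg T h n x @[n --> \oo] --> g x}.
  by apply: (birkhoff hT) => //; exact: invariant_fun.
have hg' : {ae mu, forall x, birkhoff_avg T h n x @[n --> \oo] --> `|g x|}.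
  apply: filterS hg => x hx; have := cvg_norm hx.
  have nn n : `|birkhoff_avg T h n x| = birkhoff_avg T h n x.
    by rewrite ger0_norm// mulr_ge0 ?invr_ge0// sumr_ge0.
  by under eq_fun do rewrite nn; exact.
have mng : measurable_fun setT (fun x => `|g x|) by exact: measurableT_comp.
exists (fun x => `|g x|); split; [exact: mng|by []| |exact: hg'].
- rewrite -(Eg setT); last by split; [exact: measurableT|exact: preimage_setT].
  apply: ae_eq_integral => //.
  + exact/measurable_EFinP.
  + exact/measurable_EFinP.
  apply: filterS2 hg hg' => x hx hx' _; congr EFin.
  exact: (cvg_unique _ hx' hx).
Qed.

Lemma ae_forall_count (C : countType) (P : C -> X -> Prop) :
  (forall c, {ae mu, forall x, P c x}) -> {ae mu, forall x, forall c, P c x}.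
Proof.
move=> h; have : {ae mu, forall x, forall n, forall c, unpickle n = Some c -> P c x}.
  apply: ae_foralln => n; case E: (unpickle n) => [c|]; last by apply: aeW.
  by apply: filterS (h c) => x Px c' [<-].
by apply: filterS => x hx c; apply: (hx (pickle c)); rewrite pickleK.
Qed.

Section Tensors.
Variables (p : R) (p1 : 1 <= p) (d : nat).
Notation V := (cLp mu p1).
Notation N := (@cLp_norm R disp X mu p p1).
Notation tensor := (@formal_tensor R V d).
Implicit Types (u v : tensor) (k : 'I_d -> nat).

Lemma cLp_norm00 : N 0 = 0.
Proof. by apply/cLp_norm0P; apply: aeW. Qed.

Lemma null_contraction_koopman n : null_contraction N (koopman hT n).
Proof.
split.
- by move=> x y; rewrite koopmanD subrr cLp_norm00.
- by move=> a x; rewrite koopmanZ subrr cLp_norm00.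
- by move=> x y xy; rewrite -koopmanB cLp_norm_koopman.
- by move=> x; rewrite cLp_norm_koopman.
Qed.

Lemma null_contraction_E_inv : null_contraction N (E_inv T).
Proof.
by split; [exact: (E_invD hT)|exact: (E_invZ hT)|exact: (E_inv_null hT)|exact: (cLp_norm_E_inv hT)].
Qed.

Definition koopman_slots k (i : 'I_d) : V -> V := koopman hT (k i).

Lemma formal_diag_koopman k u x : formal_diag (formal_map (koopman_slots k) u) x =
  \sum_(ct <- u) ct.1 * \prod_i ct.2 i (iter (k i) T x).
Proof. by rewrite /formal_diag big_map. Qed.

(** [koopman] preserves norms, so the weights are unchanged and slot i is evaluated at T^(k_i) x.
    Adding the other slots at this same point, which are nonnegative, completes slot i to the whole
    majorant there. *)
Lemma majorant_koopman k u x :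
  majorant (formal_map (koopman_slots k) u) x <= \sum_i majorant u (iter (k i) T x).
Proof.
rewrite /majorant big_map exchange_big /=; apply: ler_sum => -[c t] _ /=.
rewrite {1}/weight /= -mulr_sumr.
rewrite (eq_bigr (fun i => N (t i))); last by move=> i _; exact: cLp_norm_koopman.
rewrite ler_wpM2l ?(weight_ge0 (c, t))//; apply: ler_sum => i _.
rewrite /koopman_slots cLp_norm_koopman (bigD1 i)//= lerDl.
by apply: sumr_ge0 => j _; exact: powR_ge0.
Qed.

Lemma tail_majorant_koopman k (vs : nat -> tensor) J x :
  (tail_majorant (fun n => formal_map (koopman_slots k) (vs n)) J x <=
   \sum_(i < d) tail_majorant vs J (iter (k i) T x))%E.
Proof.
rewrite /tail_majorant -nneseries_sum; last by move=> *; rewrite lee_fin majorant_ge0.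
apply: lee_nneseries => [*|n *]; first by rewrite lee_fin majorant_ge0.
by rewrite sumEFin lee_fin majorant_koopman.
Qed.

Lemma summable_tensors_map (A : 'I_d -> V -> V) (vs : nat -> tensor) :
  (forall i, null_contraction N (A i)) -> summable_tensors vs ->
  summable_tensors (fun n => formal_map A (vs n)).
Proof.
move=> hA hvs n; apply: le_trans (hvs n).
by apply: formal_cost_map => // ?; exact: cLp_norm_ge0.
Qed.

Lemma box_avg_diag u : {ae mu, forall x,
  box_avg (fun k : {dffun forall i : 'I_d, 'I_(n i)} =>
    formal_diag (formal_map (koopman_slots (fun i => k i)) u) x) @[n --> multi_oo d]
  --> (formal_diag (formal_map (fun=> E_inv T) u) x : R[i]^o)}.
Proof.
(* One null set is fixed for the finitely many functions in u; the convergence is then an induction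
   on u at a fixed x. *)
have H : {ae mu, forall x, forall ct, List.In ct u -> forall i : 'I_d,
    cavg T (ct.2 i) n x @[n --> \oo] --> (E_inv T (ct.2 i) x : R[i]^o)}.
  elim: u => [|ct u IH]; first by apply: aeW.
  have h : {ae mu, forall x, forall i : 'I_d,
      cavg T (ct.2 i) n x @[n --> \oo] --> (E_inv T (ct.2 i) x : R[i]^o)}.
    by apply: filter_forall => i; exact: (birkhoff_cLp hT).
  by apply: filterS2 IH h => x h1 h2 ct' /= [<-//|]; exact: h1.
apply: filterS H => x; elim: u => [|ct u IH] Hx.
  have E0 n : box_avg (fun k : {dffun forall i : 'I_d, 'I_(n i)} =>
      formal_diag (formal_map (koopman_slots (fun i => k i)) [::]) x) = 0.
    by rewrite /box_avg [X in _ * X]big1 ?mulr0// => k _; rewrite formal_diag_koopman big_nil.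
  under eq_fun do rewrite E0.
  by rewrite [X in nbhs X]/formal_diag big_nil; exact: cvgC_cst.
have h1 := IH (fun ct' h => Hx ct' (or_intror h)).
have h2 := Hx ct (or_introl erefl).
have E n : box_avg (fun k : {dffun forall i : 'I_d, 'I_(n i)} =>
    formal_diag (formal_map (koopman_slots (fun i => k i)) (ct :: u)) x) =
  ct.1 * \prod_i cavg T (ct.2 i) (n i) x + box_avg (fun k : {dffun forall i : 'I_d, 'I_(n i)} =>
    formal_diag (formal_map (koopman_slots (fun i => k i)) u) x).
  rewrite -(box_avg_prod n (fun i j => ct.2 i (iter j T x))) -box_avgZ -box_avgD.
  congr box_avg; apply/funext => k; rewrite !formal_diag_koopman big_cons.
  by [].
under eq_fun do rewrite E.
rewrite [X in nbhs X]/formal_diag /= big_cons /=.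
apply: (cvgCD _ h1); apply: (cvgCM (@cvgC_cst _ _ (multi_oo d) _ ct.1)).
apply: (cvgC_prod (f := fun i n => cavg T (ct.2 i) (n i) x)) => i.
exact: (@cvg_multi_oo d _ _ _ i (h2 i)).
Qed.

End Tensors.

End Assemble.

(** * Almost sure convergence *)

Section Final.
Context {R : realType} {disp : measure_display} {X : measurableType disp}.
Variables (mu : probability X R) (T : X -> X) (hT : measure_preserving mu T).
Variables (p r : R) (p1 : 1 <= p) (r1 : 1 <= r) (d : nat).
Hypotheses (hd : (1 <= d)%N) (hpr : p = d%:R * r).
Notation V := (cLp mu p1).
Notation N := (@cLp_norm R disp X mu p p1).
Notation tensor := (@formal_tensor R V d).
Notation koopman_slots := (koopman_slots hT (p1 := p1)).
Implicit Types (u v : tensor) (vs : nat -> tensor).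

Let r0 : 0 < r. Proof. exact: lt_le_trans r1. Qed.

(** Birkhoff's theorem takes real-valued functions; where the tail is infinite, a null set for
    summable vs, the value is 0. *)
Definition tail_fun vs J x : R := fine (tail_majorant vs J x).

Lemma tail_fun_ge0 vs J x : 0 <= tail_fun vs J x.
Proof. by rewrite fine_ge0// tail_majorant_ge0. Qed.

Lemma measurable_tail_fun vs J : measurable_fun setT (tail_fun vs J).
Proof. exact: (measurableT_comp (fine_measurable measurableT) (measurable_tail_majorant vs J)). Qed.

Lemma integral_tail_fun vs J : summable_tensors vs ->
  (\int[mu]_x (tail_fun vs J x)%:E <= (d%:R * 2 ^- J)%:E)%E.
Proof.
move=> hvs; apply: le_trans (integral_tail_majorant J hvs).
apply: ge0_le_integral => //.
- by move=> x _; rewrite lee_fin tail_fun_ge0.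
- by apply/measurable_EFinP; exact: measurable_tail_fun.
- exact: measurable_tail_majorant.
move=> x _; rewrite /tail_fun.
by case: (tail_majorant vs J x) (tail_majorant_ge0 vs J x) => //= *; rewrite leey.
Qed.

Lemma integrable_ge0 (h : X -> R) (c : R) : measurable_fun setT h ->
  (forall x, 0 <= h x) -> (\int[mu]_x (h x)%:E <= c%:E)%E ->
  mu.-integrable setT (EFin \o h).
Proof.
move=> mh h0 hc; apply/integrableP; split; first exact/measurable_EFinP.
under eq_integral => x _ do rewrite /= ger0_norm//.
by apply: le_lt_trans hc _; rewrite ltry.
Qed.

Variable f : Lppi mu p1 d.

Definition diag_V (k : 'I_d -> nat) : cLp mu r1 := D_op r1 (V_op hT k f).
Definition diag_E : cLp mu r1 := D_op r1 (E_inv_tensor T f).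

(** One series, depending on f alone, serves all the operators: slotwise contractions commute with
    partial sums and keep the bounds on costs. The tail still depends on k, a dependence that
    [tail_majorant_koopman] removes. *)
Lemma representation : exists vs, [/\ summable_tensors vs,
  (forall k, {ae mu, forall x, forall J,
    ((normc (formal_diag (formal_map (koopman_slots k) (partial_tensor vs J.+1)) x - diag_V k x) `^ r)%:E
      <= tail_majorant (fun n => formal_map (koopman_slots k) (vs n)) J x)%E}) &
  {ae mu, forall x, formal_diag (formal_map (fun=> E_inv T) (partial_tensor vs n)) x
    @[n --> \oo] --> (diag_E x : R[i]^o)}].
Proof.
have N0 := @cLp_norm_ge0 _ _ _ mu p p1.
have [vs [s [hs hf hvs]]] := proj_tensor_series N0 f.
have main (A : 'I_d -> V -> V) : (forall i, null_contraction N (A i)) ->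
    {ae mu, forall x, formal_diag (formal_map A (partial_tensor vs n)) x
      @[n --> \oo] --> (D_op r1 (tensor_map A f) x : R[i]^o)} /\
    {ae mu, forall x, forall J,
      ((normc (formal_diag (formal_map A (partial_tensor vs J.+1)) x -
          D_op r1 (tensor_map A f) x) `^ r)%:E
        <= tail_majorant (fun n => formal_map A (vs n)) J x)%E}.
  move=> hA.
  have := @D_op_series _ _ _ mu p r p1 r1 d hd hpr (tensor_map A f)
    (fun n => formal_map A (f n)) (fun n => formal_map A (vs n)) s
    (summable_tensors_map hA hvs) hs _ (tensor_map_spec N0 f hA).
  case=> [n|h1 h2].
    by rewrite -formal_map_partial; exact: tensor_eq_map.
  split.
  - by apply: filterS h1 => x; under eq_fun do rewrite -formal_map_partial.
  - by apply: filterS h2 => x h J; rewrite formal_map_partial; exact: h.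
exists vs; split => // [k|].
- by have [_] := main (koopman_slots k) (fun i => null_contraction_koopman hT p1 (k i)).
- by have [] := main (fun=> E_inv T) (fun i => null_contraction_E_inv hT p1).
Qed.

Lemma ae_box_tail vs : summable_tensors vs ->
  (forall k, {ae mu, forall x, forall J,
    ((normc (formal_diag (formal_map (koopman_slots k) (partial_tensor vs J.+1)) x - diag_V k x) `^ r)%:E
      <= tail_majorant (fun n => formal_map (koopman_slots k) (vs n)) J x)%E}) ->
  {ae mu, forall x, forall J (k : 'I_d -> nat),
    normc (formal_diag (formal_map (koopman_slots k) (partial_tensor vs J.+1)) x - diag_V k x) `^ r
    <= \sum_i tail_fun vs J (iter (k i) T x)}.
Proof.
move=> hvs hk.
(* Multi-indices as finite functions form a countable type, so the null sets of all k merge into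
   one. *)
have hk' : {ae mu, forall x, forall (c : {ffun 'I_d -> nat}) J,
    ((normc (formal_diag (formal_map (koopman_slots c) (partial_tensor vs J.+1)) x - diag_V c x) `^ r)%:E
      <= tail_majorant (fun n => formal_map (koopman_slots c) (vs n)) J x)%E}.
  by apply: ae_forall_count => c; exact: hk.
(* Finiteness along the whole orbit of x allows [tail_fun] to replace the tail at every T^(k_i)
   x. *)
have hfin := ae_mp_iter hT (ae_tail_majorant_lty hvs).
apply: filterS2 hk' hfin => x h1 h2 J k.
have -> : k = [ffun i => k i] :> ('I_d -> nat) by apply/funext => i; rewrite ffunE.
rewrite -lee_fin; apply: le_trans (h1 _ J) _.
apply: le_trans (tail_majorant_koopman _ _ _ _ _) _; rewrite -sumEFin.
apply: lee_sum => i _; rewrite fineK// ge0_fin_numE ?tail_majorant_ge0//.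
by apply: le_lt_trans (tail_majorant_le _ _ _) (h2 _).
Qed.

Lemma box_avg_birkhoff (h : X -> R) (n : 'I_d -> nat) x : (forall i, 0 < n i)%N ->
  box_avg (fun k : {dffun forall i : 'I_d, 'I_(n i)} => \sum_i h (iter (k i) T x)) =
  \sum_i birkhoff_avg T h (n i) x.
Proof.
move=> n0; rewrite box_avg_sum; apply: eq_bigr => i _.
exact: (box_avg_coord i (fun j => h (iter j T x)) n0).
Qed.

Lemma normc_box_le (z : ('I_d -> nat) -> R[i]) (h : X -> R) x (n : 'I_d -> nat) :
  (forall k, normc (z k) `^ r <= \sum_i h (iter (k i) T x)) ->
  (forall i, 0 < n i)%N ->
  normc (box_avg (fun k : {dffun forall i : 'I_d, 'I_(n i)} => z (fun i => k i))) `^ r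
    <= \sum_i birkhoff_avg T h (n i) x.
Proof.
move=> zh n0; rewrite -box_avg_birkhoff//.
apply: le_trans (normc_box_avg _ r1 n0) _.
by apply: ler_box_avg => k; exact: zh.
Qed.

Definition averages (n : 'I_d -> nat) x : R[i] :=
  box_avg (fun k : {dffun forall i : 'I_d, 'I_(n i)} => diag_V (fun i => k i) x).

Lemma ae_averages_cvg : {ae mu, forall x,
  averages n x @[n --> multi_oo d] --> (diag_E x : R[i]^o)}.
Proof.
have [vs [hvs hk hE]] := representation.
have hh J : exists e : X -> R, [/\ measurable_fun setT e, (forall x, 0 <= e x),
    (\int[mu]_x (e x)%:E = \int[mu]_x (tail_fun vs J x)%:E)%E &
    {ae mu, forall x, birkhoff_avg T (tail_fun vs J) n x @[n --> \oo] --> e x}].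
  apply: (birkhoff_nonneg hT); last by move=> x; exact: tail_fun_ge0.
  apply: (integrable_ge0 _ _ (integral_tail_fun J hvs)).
    exact: measurable_tail_fun.
  by move=> x; exact: tail_fun_ge0.
have {hh} /(_ _)/cid hh := hh; pose e J := sval (hh J).
have he J : [/\ measurable_fun setT (e J), (forall x, 0 <= e J x),
    (\int[mu]_x (e J x)%:E = \int[mu]_x (tail_fun vs J x)%:E)%E &
    {ae mu, forall x, birkhoff_avg T (tail_fun vs J) n x @[n --> \oo] --> e J x}].
  exact: svalP (hh J).
(* The integral of [e J] is at most d 2^-J, so the sum of these functions is finite almost
   everywhere and [e J.+1 x] tends to 0. *)
have e_sum : {ae mu, forall x, (\sum_(J <oo) (e J.+1 x)%:E < +oo)%E}.
  apply: (@ae_nneseries_lty _ _ _ mu _ (fun J => d%:R * 2 ^- J.+1)).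
  - by move=> J; apply/measurable_EFinP; case: (he J.+1).
  - by move=> J x; rewrite lee_fin; case: (he J.+1).
  - by move=> J; case: (he J.+1) => _ _ -> _; exact: integral_tail_fun.
  apply: (@le_lt_trans _ _ d%:R%:E); last exact: ltry.
  apply: lime_le.
    by apply: is_cvg_nneseries => i *; rewrite lee_fin mulr_ge0 ?invr_ge0 ?exprn_ge0.
  apply: nearW => m; rewrite big_mkord sumEFin lee_fin -mulr_sumr.
  rewrite ler_piMr//; have := @geometric_tail R 0 m.
  by under eq_bigr do rewrite addn0; rewrite expr0 invr1.
have e_cvg : {ae mu, forall x, forall J,
    birkhoff_avg T (tail_fun vs J) n x @[n --> \oo] --> e J x}.
  by apply: ae_foralln => J; case: (he J).
have u_cvg : {ae mu, forall x, forall J, box_avg (fun k : {dffun forall i : 'I_d, 'I_(n i)} =>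
    formal_diag (formal_map (koopman_slots (fun i => k i)) (partial_tensor vs J)) x) @[n --> multi_oo d]
  --> (formal_diag (formal_map (fun=> E_inv T) (partial_tensor vs J)) x : R[i]^o)}.
  by apply: ae_foralln => J; exact: box_avg_diag.
have tail := ae_box_tail hvs hk.
apply: filter_app e_sum; apply: filter_app e_cvg.
apply: filterS3 u_cvg tail hE => x hu ht hEx hec hs.
apply/cvg_normcP/cvgrPdist_le => eps eps0.
have eps3 : 0 < eps / 3 by rewrite divr_gt0.
have eps3r : 0 < (eps / 3) `^ r by exact: powR_gt0.
(* The denominator d + 1 instead of d leaves a strict gap: the averages only converge to [e J.+1 x],
   and have to end below the bound with d. *)
have epsd : 0 < (eps / 3) `^ r / (d%:R + 1) by rewrite divr_gt0// ltr_pwDr.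
have [J0 _ hJ0] : \forall J \near \oo, e J.+1 x <= (eps / 3) `^ r / (d%:R + 1).
  have h0 i : (0 <= (e i.+1 x)%:E)%E by rewrite lee_fin; case: (he i.+1).
  have := nneseries_tail_cvg hs (fun i _ => h0 i).
  have t0 J : (0 <= \sum_(J <= i <oo) (e i.+1 x)%:E)%E by exact: nneseries_ge0.
  move/(cvge0_leP _ t0) => /(_ _ epsd); apply: filterS => J hJ.
  rewrite -lee_fin; apply: le_trans hJ.
  have := @nneseries_lim_ge R (fun i => (e i.+1 x)%:E) xpredT J J.+1 (fun i _ _ => h0 i).
  by rewrite big_nat1.
have [J1 _ hJ1] : \forall n \near \oo,
    normc (formal_diag (formal_map (fun=> E_inv T) (partial_tensor vs n)) x - diag_E x) <= eps / 3.
  move/cvg_normcP/cvgrPdist_le : hEx => /(_ _ eps3); apply: filterS => n.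
  by rewrite sub0r normrN ger0_norm ?normc_ge0.
pose J := (J0 + J1)%N.
have eJ : e J.+1 x < (eps / 3) `^ r / d%:R.
  apply: le_lt_trans (hJ0 J _) _; first by rewrite /= leq_addr.
  by rewrite ltr_pM2l// ltf_pV2 ?posrE ?ltr0n ?ltr_pwDr// ltrDl.
have near1 : \forall n \near multi_oo d, forall i,
    birkhoff_avg T (tail_fun vs J.+1) (n i) x <= (eps / 3) `^ r / d%:R.
  apply: filter_forall => i.
  have c := @cvg_multi_oo d _ _ _ i (hec J.+1).
  by move/cvgrPdist_lt : c => /(_ ((eps / 3) `^ r / d%:R - e J.+1 x));
    rewrite subr_gt0 => /(_ eJ); apply: filterS => n; rewrite ltr_distlC => /andP[_ /ltW];
    rewrite addrC subrK.
(* The order J + 2 matches [tail_fun vs J.+1], which controls the distance to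
   [partial_tensor vs J.+2]. *)
have near2 : \forall n \near multi_oo d, normc (box_avg (fun k : {dffun forall i : 'I_d, 'I_(n i)} =>
    formal_diag (formal_map (koopman_slots (fun i => k i)) (partial_tensor vs J.+2)) x) -
    formal_diag (formal_map (fun=> E_inv T) (partial_tensor vs J.+2)) x) <= eps / 3.
  move/cvg_normcP/cvgrPdist_le : (hu J.+2) => /(_ _ eps3); apply: filterS => n.
  by rewrite sub0r normrN ger0_norm ?normc_ge0.
apply: filterS3 near1 near2 multi_oo_gt0 => n h1 h2 n0.
rewrite sub0r normrN ger0_norm ?normc_ge0//.
set U := box_avg _ in h2; set W := formal_diag _ _ in h2.
(* Truncation inside the averages, averaging of the finite tensor, truncation in the limit. *)
have -> : averages n x - diag_E x = (averages n x - U) + ((U - W) + (W - diag_E x)).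
  by rewrite !addrA !subrK.
apply: le_trans (le_normcD _ _) _.
have -> : eps = eps / 3 + (eps / 3 + eps / 3) by lra.
apply: lerD; last first.
  apply: le_trans (le_normcD _ _) _; apply: lerD => //.
  by apply: hJ1; rewrite /= /J -addn2 -addnA addnCA leq_addr.
apply: (powR_le_cancel r1); [exact: normc_ge0|exact: ltW|].
rewrite normcB /U /averages -box_avgB.
apply: le_trans (normc_box_le (ht J.+1) n0) _.
apply: (@le_trans _ _ (\sum_(i < d) (eps / 3) `^ r / d%:R)).
  by apply: ler_sum => i _; exact: h1.
by rewrite sumr_const card_ord -[X in X <= _]mulr_natl mulrC divfK// pnatr_eq0 -lt0n.
Qed.

End Final.

(** * Convergence in L_r *)

Section Norm.
Context {R : realType} {disp : measure_display} {X : measurableType disp}.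
Variables (mu : probability X R) (T : X -> X) (hT : measure_preserving mu T).
Variables (p r : R) (p1 : 1 <= p) (r1 : 1 <= r) (d : nat).
Hypotheses (hd : (1 <= d)%N) (hpr : p = d%:R * r).
Variable f : Lppi mu p1 d.
Notation N := (@cLp_norm R disp X mu p p1).
Notation avg := (averages hT r1 f).
Notation limit := (diag_E T r1 f).

Let r0 : 0 < r. Proof. exact: lt_le_trans r1. Qed.

Lemma cvg_sum_seq (I : Type) (F : set_system I) (FF : Filter F) (J : Type)
    (s : seq J) (u : J -> I -> R) (a : J -> R) :
  (forall j, u j i @[i --> F] --> a j) ->
  \sum_(j <- s) u j i @[i --> F] --> \sum_(j <- s) a j.
Proof.
move=> ua; elim: s => [|j s IH].
  by rewrite big_nil; under eq_fun do rewrite big_nil; exact: cvg_cst.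
by rewrite big_cons; under eq_fun do rewrite big_cons; exact: (cvgD (ua j) IH).
Qed.

(** The case J = 0: f splits into the term [vs 0], whose cost is absorbed by W, and the tail. The
    bound varies with the box, so plain dominated convergence does not apply; [pratt] does, since
    the integral of the bound stays the same. *)
Lemma averages_domination : exists h : X -> R,
  [/\ measurable_fun setT h, (forall x, 0 <= h x),
      mu.-integrable setT (EFin \o h) &
      {ae mu, forall x, forall n, (forall i, 0 < n i)%N ->
        normc (avg n x) `^ r <= \sum_i birkhoff_avg T h (n i) x}].
Proof.
have [vs [hvs hk _]] := representation hT r1 hd hpr f.
pose W : R := Num.max 1 (formal_cost N (partial_tensor vs 1)).
have W1 : 1 <= W by rewrite /W le_max lexx.
have W0 : 0 <= W `^ r by exact: powR_ge0.
pose u := partial_tensor vs 1.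
pose h x := 2 `^ r * (W `^ r * majorant u x + tail_fun vs 0 x).
have mh1 : measurable_fun setT (fun x => W `^ r * majorant u x).
  by apply: measurable_funM => //; exact: measurable_majorant.
have mh : measurable_fun setT h.
  by apply: measurable_funM => //; apply: measurable_funD => //; exact: measurable_tail_fun.
have h0 x : 0 <= h x.
  by rewrite mulr_ge0 ?powR_ge0// addr_ge0 ?tail_fun_ge0// mulr_ge0// majorant_ge0.
exists h; split => //.
  apply: (@integrable_ge0 _ _ _ mu h
    (2 `^ r * (W `^ r * (d%:R * formal_cost N u) + d%:R * 2 ^- 0))) => //.
  under eq_integral do rewrite /h EFinM.
  rewrite ge0_integralZl_EFin ?powR_ge0//; last 2 first.
  - by move=> x _; rewrite lee_fin addr_ge0 ?tail_fun_ge0// mulr_ge0// majorant_ge0.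
  - by apply/measurable_EFinP; apply: measurable_funD => //; exact: measurable_tail_fun.
  rewrite [leRHS]EFinM; apply: lee_wpmul2l; first by rewrite lee_fin powR_ge0.
  under eq_integral do rewrite EFinD.
  rewrite ge0_integralD//; last 4 first.
  - by move=> x _; rewrite lee_fin mulr_ge0// majorant_ge0.
  - exact/measurable_EFinP.
  - by move=> x _; rewrite lee_fin tail_fun_ge0.
  - by apply/measurable_EFinP; exact: measurable_tail_fun.
  rewrite EFinD; apply: leeD; last exact: integral_tail_fun.
  under eq_integral do rewrite EFinM.
  rewrite ge0_integralZl_EFin//; last 2 first.
  - by move=> x _; rewrite lee_fin majorant_ge0.
  - by apply/measurable_EFinP; exact: measurable_majorant.
  by rewrite EFinM; apply: lee_wpmul2l; [rewrite lee_fin|exact: integral_majorant].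
have hu : {ae mu, forall x, forall c : {ffun 'I_d -> nat},
    normc (formal_diag (formal_map (koopman_slots hT c) u) x) `^ r <=
    W `^ r * majorant (formal_map (koopman_slots hT c) u) x}.
  apply: ae_forall_count => c; apply: (diag_powR_le r1 hd hpr W1).
  apply: (@le_trans _ _ (formal_cost N u)); last by rewrite le_max lexx orbT.
  apply: formal_cost_map => [?|i]; first exact: cLp_norm_ge0.
  exact: null_contraction_koopman.
apply: filterS2 (ae_box_tail hvs hk) hu => x ht hx n n0.
apply: (normc_box_le r1 (z := fun k => diag_V hT r1 f k x)) => // k.
pose c : {ffun 'I_d -> nat} := [ffun i => k i].
have kc : k = c :> ('I_d -> nat) by apply/funext => i; rewrite ffunE.
set D := diag_V _ _ _ _ _; pose E := formal_diag (formal_map (koopman_slots hT k) u) x.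
apply: (@le_trans _ _ (2 `^ r * (normc E `^ r + normc (E - D) `^ r))).
  apply: le_trans (powRD_le r1 (normc_ge0 _) (normc_ge0 _)).
  rewrite ge0_ler_powR ?(ltW r0) ?nnegrE ?addr_ge0 ?normc_ge0//.
  by rewrite [normc (E - D)]normcB -[X in normc X <= _](subrKC E) le_normcD.
rewrite /h -mulr_sumr ler_wpM2l ?powR_ge0// big_split /=; apply: lerD; last exact: (ht 0%N k).
rewrite -mulr_sumr; apply: (@le_trans _ _ (W `^ r * majorant (formal_map (koopman_slots hT k) u) x)).
  by rewrite /E kc; exact: hx.
by rewrite ler_wpM2l// majorant_koopman.
Qed.

Lemma cmeasurable_avg n : cmeasurable (avg n).
Proof.
apply: cmeasurableM; first exact: cmeasurable_cst.
by apply: cmeasurable_sum => k; exact: cLp_cmeasurable.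
Qed.

Lemma averages_cvg_pint :
  pint mu r (fun x => avg n x - limit x) @[n --> multi_oo d] --> 0%E.
Proof.
apply/cvge0_leP => [n|eps eps0]; first exact: pint_ge0.
apply: contrapT => /multi_oo_counterexample[ns [nsm nP]].
have ns0 m i : (0 < ns m i)%N by apply: leq_trans (nsm m i).
have [h [mh h0 ih hdom]] := averages_domination.
have [e [me e0 eh ecvg]] := birkhoff_nonneg hT ih h0.
have ml := cLp_cmeasurable limit.
have mlr : measurable_fun setT (fun x => normc (limit x) `^ r).
  exact: measurable_normc_powR.
pose F m x := normc (avg (ns m) x - limit x) `^ r.
pose G m x := 2 `^ r * (\sum_i birkhoff_avg T h (ns m i) x + normc (limit x) `^ r).
pose g x := 2 `^ r * (\sum_(i < d) e x + normc (limit x) `^ r).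
have hfin : (\int[mu]_x (h x)%:E \is a fin_num)%E by exact: integrable_fin_num.
(* The common integral of g and of all the [G m]: the Birkhoff averages of h and their limit e all
   have the integral of h. *)
pose c : R := 2 `^ r * (\sum_(i < d) fine (\int[mu]_x (h x)%:E)%E + cLp_norm limit `^ r).
have avg0 m i x : 0 <= birkhoff_avg T h (ns m i) x.
  by rewrite mulr_ge0 ?invr_ge0// sumr_ge0.
have mavg m i : measurable_fun setT (birkhoff_avg T h (ns m i)).
  by apply: measurable_funM => //; exact: (measurable_birkhoff_sum hT).
have intc (w : 'I_d -> X -> R) : (forall i, measurable_fun setT (w i)) ->
    (forall i x, 0 <= w i x) ->
    (forall i, (\int[mu]_x (w i x)%:E = \int[mu]_x (h x)%:E)%E) ->
    (\int[mu]_x (2 `^ r * (\sum_i w i x + normc (limit x) `^ r))%:E = c%:E)%E.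
  move=> mw w0 iw.
  have ms : measurable_fun setT (fun x => \sum_i w i x) by exact: measurable_sum.
  under eq_integral do rewrite EFinM.
  rewrite ge0_integralZl_EFin ?powR_ge0//; last 2 first.
  - by move=> x _; rewrite lee_fin addr_ge0 ?powR_ge0// sumr_ge0.
  - by apply/measurable_EFinP; exact: measurable_funD.
  rewrite [RHS]EFinM; congr (_ * _)%E; under eq_integral do rewrite EFinD.
  rewrite ge0_integralD//; last 4 first.
  - by move=> x _; rewrite lee_fin sumr_ge0.
  - exact/measurable_EFinP.
  - by move=> x _; rewrite lee_fin powR_ge0.
  - exact/measurable_EFinP.
  rewrite EFinD -/(pint mu r limit) pint_cLp; congr (_ + _)%E.
  under eq_integral do rewrite -sumEFin.
  rewrite ge0_integral_sum//; last 2 first.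
  - by move=> i; exact/measurable_EFinP.
  - by move=> i x _; rewrite lee_fin.
  by rewrite -sumEFin; apply: eq_bigr => i _; rewrite iw fineK.
have key := @pratt _ _ _ mu F G g c eps.
apply: key => //.
- move=> m; apply: measurable_normc_powR; apply: cmeasurableB => //.
  exact: cmeasurable_avg.
- move=> m; apply: measurable_funM => //; apply: measurable_funD => //.
  exact: measurable_sum.
- apply: measurable_funM => //; apply: measurable_funD => //.
  exact: measurable_sum.
- by move=> m x; exact: powR_ge0.
- move=> m; apply: filterS hdom => x hx.
  apply: (@le_trans _ _ (2 `^ r * (normc (avg (ns m) x) `^ r + normc (limit x) `^ r))).
    apply: le_trans (powRD_le r1 (normc_ge0 _) (normc_ge0 _)).
    rewrite ge0_ler_powR ?(ltW r0) ?nnegrE ?addr_ge0 ?normc_ge0//.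
    by rewrite -[normc (limit x)]normcN le_normcD.
  by rewrite ler_wpM2l ?powR_ge0// lerD2r; exact: hx.
- apply: filterS (ae_averages_cvg hT r1 hd hpr f) => x hx.
  rewrite -(powR0 (x := r)) ?gt_eqF//.
  apply: cvg_powRl => // [m|]; first exact: normc_ge0.
  apply/cvg_normcP.
  exact: (cvg_comp ns (fun n => avg n x) (multi_oo_seq (fun m i => ltnW (nsm m i))) hx).
- apply: filterS ecvg => x hx; apply: cvgM; first exact: cvg_cst.
  apply: cvgD; last exact: cvg_cst.
  apply: (@cvg_sum_seq nat _ _ _ (index_enum 'I_d) (fun i m => birkhoff_avg T h (ns m i) x)) => i.
  apply: (cvg_comp (fun m => ns m i) (fun n => birkhoff_avg T h n x) _ hx).
  move=> P [M _ hM]; exists M => // m /= Mm; apply: hM => /=.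
  exact: leq_trans Mm (ltnW (nsm m i)).
- by move=> m; apply: intc => // i; exact: integral_birkhoff_avg.
- exact: intc.
- move=> m; have /negP := nP m; rewrite -ltNge => /ltW; exact.
Qed.
End Norm.

Local Close Scope complex_scope.

Theorem mainTheorem2 (R : realType) (disp : measure_display)
    (X : measurableType disp) (mu : probability X R)
    (hX : standard_probability mu)
    (T : X -> X) (hT : measure_preserving mu T)
    (d : nat) (hd : (1 <= d)%N) (r p : R) (r1 : 1 <= r) (p1 : 1 <= p)
    (hpr : p = d%:R * r) (f : Lppi mu p1 d) :
  let averages (n : 'I_d -> nat) (x : X) : R[i] :=
    (\prod_(i < d) (n i)%:R)^-1 *
    \sum_(k : {dffun forall i : 'I_d, 'I_(n i)})
      D_op r1 (V_op hT (fun i => k i) f) x in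
  let limit : cLp mu r1 := D_op r1 (E_inv_tensor T f) in
  {ae mu, forall x,
     averages n x @[n --> multi_oo d] --> (limit x : R[i]^o)} /\
  (cLnorm mu r (fun x => averages n x - limit x) @[n --> multi_oo d] --> 0%E).
Proof.
split; first exact: (ae_averages_cvg hT r1 hd hpr f).
by apply/cLnorm_cvg0P => //; exact: (averages_cvg_pint hT r1 hd hpr f).
Qed.
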